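(* Let $K$ be a field, let $Q$ be a finite loop-free quiver, $S$ a potential on $Q$, $k\in Q_0$ a vertex not incident to any $2$-cycle of $Q$, and $\mathcal M=(M,V)$ a decorated $\mathcal P(Q,S)$-module (no finite-dimensionality assumed). Let $\overline M$ be the $K\langle\langle\widetilde\mu_k(Q)\rangle\rangle$-module with action $\widetilde\eta$ defined in the context. Then the Jacobian ideal $J(\widetilde\mu_k(S))\subseteq K\langle\langle\widetilde\mu_k(Q)\rangle\rangle$ annihilates $\overline M$.
   Context: **Quivers and potentials.** $K$ is an arbitrary field; modules are left modules. A quiver $Q=(Q_0,Q_1,h,t)$ is finite and loop-free; an arrow $a$ goes from $t(a)$ to $h(a)$. Paths are composed as functions: $c_1c_2\cdots c_d$ is a path if $t(c_i)=h(c_{i+1})$. $e_j$ is the length-$0$ path at $j$. $K\langle Q\rangle$ is the path algebra, $K\langle\langle Q\rangle\rangle$ the complete path algebra (possibly infinite linear combinations of paths), $\mathfrak m$ its ideal generated by the arrows, with the $\mathfrak m$-adic topology. $K^{Q_0}=\prod_{j\in Q_0}K$. A potential $S$ is a possibly infinite linear combination of cyclic paths of positive length; $(Q,S)$ is a QP. For a cyclic path, $\partial_a(c_1\cdots c_d)=\sum_{i:c_i=a}c_{i+1}\cdots c_dc_1\cdots c_{i-1}$, and for arrows $a,b$ with $h(a)=t(b)$, $\partial_{ba}(c_1\cdots c_d)=\sum_{i:\,c_ic_{i+1}=ba}c_{i+2}\cdots c_dc_1\cdots c_{i-1}$ (indices mod $d$); both are extended linearly and continuously. $J(S)$ is the $\mathfrak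 m$-adic closure of the two-sided ideal generated by all $\partial_a(S)$, and $\mathcal P(Q,S)=K\langle\langle Q\rangle\rangle/J(S)$. Two potentials are cyclically equivalent if their difference lies in the closure of the span of the elements $c_1\cdots c_d-c_2\cdots c_dc_1$ ($c_1\cdots c_d$ a cyclic path). A decorated $\mathcal P(Q,S)$-module is a pair $(M,V)$ with $M$ a left $\mathcal P(Q,S)$-module and $V$ a left $K^{Q_0}$-module; $M_j=e_jM$, and $u_M$ is the action of $u$ on $M$. **Premutation.** $\widetilde\mu_k(Q)$ has vertex set $Q_0$; its arrows are: the arrows of $Q$ not incident to $k$; an arrow $[ba]:t(a)\to h(b)$ for each pair $a,b\in Q_1$ with $h(a)=k=t(b)$; and an arrow $c^*$ opposite to $c$ for each $c\in Q_1$ incident to $k$. $\widetilde\mu_k(S)=[S]+\sum_{h(a)=k=t(b)}b^*[ba]a^*$, where $[S]$ is obtained from $S$ (replaced if necessary by a cyclically equivalent potential none of whose cycles starts at $k$) by replacing each occurrence of $ba$ with $h(a)=k=t(b)$ by the arrow $[ba]$. **Triangle.** Let $a_1,\dots,a_s$ (resp. $b_1,\dots,b_r$) be the arrows of $Q$ ending (resp. starting) at $k$. Put $M_{\rm in}=\bigoplus_iM_{t(a_i)}$, $M_{\rm out}=\bigoplus_jM_{h(b_j)}$, $\alpha=[(a_1)_M\cdots(a_s)_M]:M_{\rm in}\to M_k$, $\beta=[(b_1)_M\cdots(b_r)_M]^{T}:M_k\to M_{\rm out}$, and $\gamma:M_{\rm out}\to M_{\rm in}$ with $(i,j)$ entry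 $(\partial_{b_ja_i}(S))_M$. One has $\alpha\gamma=0=\gamma\beta$. Fix a linear retraction $\rho:M_{\rm out}\to\ker\gamma$ of the inclusion and a linear section $\sigma:\ker\alpha/\operatorname{im}\gamma\to\ker\alpha$ of the projection. $\iota$ denotes inclusions into $M_{\rm in}$; $p:M_{\rm out}\to\operatorname{coker}\beta$ is the projection (also its restriction $\ker\gamma\to\ker\gamma/\operatorname{im}\beta$); $\overline\gamma:\operatorname{coker}\beta\to M_{\rm in}$ is induced by $\gamma$. **$\overline M$.** $\overline M_j=M_j$ for $j\ne k$; and $\overline M_k$, $\overline\alpha:M_{\rm out}\to\overline M_k$, $\overline\beta:\overline M_k\to M_{\rm in}$ are given by any one of the following (mutually isomorphic) descriptions: (A) $\overline M_k=\frac{\ker\gamma}{\operatorname{im}\beta}\oplus\operatorname{im}\gamma\oplus\frac{\ker\alpha}{\operatorname{im}\gamma}\oplus V_k$, $\overline\alpha=[-p\rho,\,-\gamma,\,0,\,0]^T$, $\overline\beta=[0,\ \iota,\ \iota\sigma,\ 0]$; (B) $\overline M_k=\frac{\ker\gamma}{\operatorname{im}\beta}\oplus\ker\alpha\oplus V_k$, $\overline\alpha=[-p\rho,\,-\gamma,\,0]^T$, $\overline\beta=[0,\ \iota,\ 0]$; (C) $\overline M_k=\operatorname{coker}\beta\oplus\frac{\ker\alpha}{\operatorname{im}\gamma}\oplus V_k$, $\overline\alpha=[-p,\,0,\,0]^T$, $\overline\beta=[\overline\gamma,\ \iota\sigma,\ 0]$. Put $\overline M=\bigoplus_j\overline M_j$.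 $\overline M$ is a representation of $\widetilde\mu_k(Q)$: arrows $c$ of $Q$ not incident to $k$ act as $c_M$, $[ba]$ acts as $b_Ma_M$, and $(a_i^* )_{\overline M}:\overline M_k\to M_{t(a_i)}$, $(b_j^* )_{\overline M}:M_{h(b_j)}\to\overline M_k$ are the components of $\overline\beta$ and $\overline\alpha$. Let $\eta:K\langle\widetilde\mu_k(Q)\rangle\to\operatorname{End}_K(\overline M)$ be the corresponding action. **$\widetilde\eta$.** Let $e_{\widehat k}=1-e_k$. For a quiver $Q'$ on $Q_0$, $e_{\widehat k}Q'e_{\widehat k}$ is $Q'$ with $k$ and all arrows incident to $k$ deleted. $\kappa:e_{\widehat k}K\langle\langle\widetilde\mu_k(Q)\rangle\rangle e_{\widehat k}\to K\langle\langle e_{\widehat k}\widetilde\mu_k^2(Q)e_{\widehat k}\rangle\rangle$ is the algebra isomorphism replacing each occurrence of a length-$2$ path $a^*b^*$ ($h(a)=k=t(b)$) by the arrow $[a^*b^*]$. $\psi:K\langle\langle e_{\widehat k}\widetilde\mu_k^2(Q)e_{\widehat k}\rangle\rangle\to e_{\widehat k}K\langle\langle Q\rangle\rangle e_{\widehat k}$ is the unique algebra homomorphism fixing each $e_j$ ($j\neq k$) with $\psi(c)=c$ for $c\in Q_1$ not incident to $k$, $\psi([ba])=ba$, $\psi([a^*b^*])=-\partial_{ba}(S)$. $\widetilde\rho:K\langle\langle Q\rangle\rangle\to\operatorname{End}_K(M)$ is the action on $M$, restricted to $e_{\widehat k}K\langle\langle Q\rangle\rangle e_{\widehat k}\to\operatorname{End}_K(e_{\widehat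 k}M)$. $\theta:\operatorname{End}_K(e_{\widehat k}M)\to\operatorname{End}_K(\overline M)$ sends $f$ to $\overline M\twoheadrightarrow e_{\widehat k}M\xrightarrow{f}e_{\widehat k}M\hookrightarrow\overline M$. Every $u\in A:=K\langle\langle\widetilde\mu_k(Q)\rangle\rangle$ is uniquely $$u=ze_k+u_{\widehat k}+\sum_iv_ia_i^*+\sum_jb_j^*w_j+\sum_{i,j}b_j^*x_{ij}a_i^*$$ with $z\in K$, $u_{\widehat k}\in e_{\widehat k}Ae_{\widehat k}$, $v_i\in e_{\widehat k}Ae_{t(a_i)}$, $w_j\in e_{h(b_j)}Ae_{\widehat k}$, $x_{ij}\in e_{h(b_j)}Ae_{t(a_i)}$. With $\Theta:=\theta\widetilde\rho\psi\kappa$, the action is $$\widetilde\eta(u)=\eta(ze_k)+\Theta(u_{\widehat k})+\sum_i\Theta(v_i)\eta(a_i^* )+\sum_j\eta(b_j^* )\Theta(w_j)+\sum_{i,j}\eta(b_j^* )\Theta(x_{ij})\eta(a_i^* ),$$ and $\widetilde\eta$ is an algebra homomorphism $A\to\operatorname{End}_K(\overline M)$. *)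

(* Defs.v *)
From HB Require Import structures.
From mathcomp Require Import all_boot all_order all_algebra.
From mathcomp Require Import boolp classical_sets functions cardinality fsbigop.

Set Implicit Arguments.
Unset Strict Implicit.
Unset Printing Implicit Defensive.

Import GRing.Theory.

Local Open Scope ring_scope.
Local Open Scope classical_set_scope.
Local Open Scope quotient_scope.

Record subspace (K : pzRingType) (V : lmodType K) := Subspace {
  subspace_set :> V -> Prop;
  subspace0 : subspace_set 0;
  subspaceP : forall (c : K) (x y : V),
    subspace_set x -> subspace_set y -> subspace_set (c *: x + y) }.

Section SubspaceType.
Variables (K : pzRingType) (V : lmodType K) (U : subspace V).

Definition subspace_pred : {pred V} := fun x => `[< U x >].

Fact subspace_pred_closed : subsemimod_closed subspace_pred.
Proof.
split; first split.
- exact/asboolP/subspace0.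
- move=> x y /asboolP Ux /asboolP Uy; apply/asboolP.
  by rewrite -[x]scale1r; apply: subspaceP.
- move=> c x /asboolP Ux; apply/asboolP.
  by rewrite -[_ *: x]addr0; apply: subspaceP => //; apply: subspace0.
Qed.

HB.instance Definition _ :=
  GRing.isSubmodClosed.Build K V subspace_pred subspace_pred_closed.

Definition subsp := {x : V | x \in subspace_pred}.

HB.instance Definition _ := SubChoice.on subsp.
HB.instance Definition _ := [SubChoice_isSubLmodule of subsp by <:].

(* [x] seen as an element of [U]; only used for [x] in [U] *)
Definition in_subsp (x : V) : subsp := insubd 0 x.

Definition quotsp := Quotient.quot subspace_pred.

HB.instance Definition _ := Choice.on quotsp.
HB.instance Definition _ := GRing.Zmodule.on quotsp.
HB.instance Definition _ := EqQuotient.on quotsp.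

Definition quotsp_scale (c : K) (x : quotsp) : quotsp := \pi_quotsp (c *: repr x).

Definition quotsp_pi (x : V) : quotsp := \pi_quotsp x.

Fact quotsp_reprK (x : quotsp) : quotsp_pi (repr x) = x.
Proof. exact: reprK. Qed.

Fact quotsp_scaleE c (x : V) : quotsp_scale c (quotsp_pi x) = quotsp_pi (c *: x).
Proof.
apply/eqP; rewrite -Quotient.idealrBE -scalerBr.
by apply: rpredZ; rewrite Quotient.idealrBE reprK.
Qed.

Fact quotsp_piD (x y : V) : quotsp_pi (x + y) = quotsp_pi x + quotsp_pi y.
Proof. exact: (raddfD \pi_(Quotient.quot subspace_pred)). Qed.

Fact quotsp_scaleA a b x :
  quotsp_scale a (quotsp_scale b x) = quotsp_scale (a * b) x.
Proof.
rewrite -[x]quotsp_reprK (quotsp_scaleE b) (quotsp_scaleE a) scalerA.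
by rewrite quotsp_scaleE.
Qed.

Fact quotsp_scale1 : left_id 1 quotsp_scale.
Proof. by move=> x; rewrite -[x]quotsp_reprK quotsp_scaleE scale1r. Qed.

Fact quotsp_scaleDr : right_distributive quotsp_scale +%R.
Proof.
move=> c x y; rewrite -[x]quotsp_reprK -[y]quotsp_reprK -quotsp_piD.
by rewrite (quotsp_scaleE c (repr x)) (quotsp_scaleE c (repr y))
  (quotsp_scaleE c (_ + _)) scalerDr quotsp_piD.
Qed.

Fact quotsp_scaleDl x : {morph quotsp_scale^~ x : a b / a + b}.
Proof.
move=> a b; rewrite -[x]quotsp_reprK (quotsp_scaleE a) (quotsp_scaleE b).
by rewrite (quotsp_scaleE (a + b)) scalerDl quotsp_piD.
Qed.

HB.instance Definition _ := GRing.Zmodule_isLmodule.Build K quotsp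
  quotsp_scaleA quotsp_scale1 quotsp_scaleDr quotsp_scaleDl.

End SubspaceType.

Section Span.
Variables (K : pzRingType) (V : lmodType K) (X : set V).
#[local] Obligation Tactic := idtac.

Program Definition lin_span : subspace V :=
  @Subspace K V (fun x => forall U : subspace V, X `<=` U -> U x) _ _.
Next Obligation. by move=> U _; apply: subspace0. Qed.
Next Obligation.
by move=> c x y Sx Sy U XU; apply: subspaceP; [apply: Sx|apply: Sy].
Qed.

End Span.

Section SubspaceConstructions.
#[local] Obligation Tactic := idtac.
Variables (K : pzRingType) (V W : lmodType K) (f : {linear V -> W}).

Definition fullsp : subspace V :=
  @Subspace K V (fun => True) I (fun _ _ _ _ _ => I).

Program Definition imagesp (U : subspace V) : subspace W :=
  @Subspace K W (fun y => exists2 x, U x & y = f x) _ _.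
Next Obligation. by move=> U; exists 0; [exact: subspace0|rewrite linear0]. Qed.
Next Obligation.
move=> U c _ _ [x Ux ->] [y Uy ->]; exists (c *: x + y); first exact: subspaceP.
by rewrite linearP.
Qed.

Program Definition kersp (U : subspace V) : subspace V :=
  @Subspace K V (fun x => U x /\ f x = 0) _ _.
Next Obligation. by move=> U; split; [exact: subspace0|exact: linear0]. Qed.
Next Obligation.
move=> U c x y [Ux fx] [Uy fy]; split; first exact: subspaceP.
by rewrite linearP fx fy scaler0 addr0.
Qed.

(* The quotient [subquot U W] is [U / W] when [W] is contained in [U]. *)
Program Definition subsp_in (U W : subspace V) : subspace (subsp U) :=
  @Subspace K (subsp U) (fun x => W (val x)) _ _.
Next Obligation. by move=> U W'; apply: subspace0. Qed.
Next Obligation. by move=> U W' c x y Wx Wy; apply: subspaceP. Qed.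

Definition subquot (U W : subspace V) : lmodType K := quotsp (subsp_in U W).

Program Definition dirsum (I : finType) (U : I -> subspace V) :
    subspace {ffun I -> V} :=
  @Subspace K {ffun I -> V} (fun x => forall i, U i (x i)) _ _.
Next Obligation. by move=> I U i; rewrite ffunE; apply: subspace0. Qed.
Next Obligation. by move=> I U c x y Ux Uy i; rewrite !ffunE; apply: subspaceP. Qed.

End SubspaceConstructions.

Record tsideal (R : pzRingType) := TSIdeal {
  tsideal_set :> R -> Prop;
  tsideal0 : tsideal_set 0;
  tsidealB : forall x y, tsideal_set x -> tsideal_set y -> tsideal_set (x - y);
  tsidealMl : forall a x, tsideal_set x -> tsideal_set (a * x);
  tsidealMr : forall a x, tsideal_set x -> tsideal_set (x * a) }.

Section Ideals.
Variable R : pzRingType.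
#[local] Obligation Tactic := idtac.

Definition fullideal : tsideal R :=
  @TSIdeal R (fun => True) I (fun _ _ _ _ => I) (fun _ _ _ => I) (fun _ _ _ => I).

Program Definition ideal_gen (X : set R) : tsideal R :=
  @TSIdeal R (fun x => forall I : tsideal R, X `<=` I -> I x) _ _ _ _.
Next Obligation. by move=> X I _; apply: tsideal0. Qed.
Next Obligation.
by move=> X x y Ix Iy I XI; apply: tsidealB; [apply: Ix|apply: Iy].
Qed.
Next Obligation. by move=> X a x Ix I XI; apply: tsidealMl; apply: Ix. Qed.
Next Obligation. by move=> X a x Ix I XI; apply: tsidealMr; apply: Ix. Qed.

Fixpoint ideal_pow (I : tsideal R) (n : nat) : tsideal R :=
  if n is n'.+1
  then ideal_gen [set z | exists x y, [/\ I x, ideal_pow I n' y & z = x * y]]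
  else fullideal.

Definition adic_closure (I : tsideal R) (X : set R) : set R :=
  [set u : R | forall n, exists2 x, X x & ideal_pow I n (u - x)].

Program Definition adic_closure_ideal (I J : tsideal R) : tsideal R :=
  @TSIdeal R (adic_closure I J) _ _ _ _.
Next Obligation.
move=> I J n; exists 0; first exact: tsideal0.
by rewrite subr0; apply: tsideal0.
Qed.
Next Obligation.
move=> I J x y Jx Jy n; have [x' Jx' xx'] := Jx n; have [y' Jy' yy'] := Jy n.
exists (x' - y'); first exact: tsidealB.
have -> : x - y - (x' - y') = (x - x') - (y - y').
  by rewrite !opprB addrACA [RHS]addrACA [- y + _]addrC.
exact: tsidealB.
Qed.
Next Obligation.
move=> I J a x Jx n; have [x' Jx' xx'] := Jx n; exists (a * x').
  exact: tsidealMl.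
by rewrite -mulrBr; apply: tsidealMl.
Qed.
Next Obligation.
move=> I J a x Jx n; have [x' Jx' xx'] := Jx n; exists (x' * a).
  exact: tsidealMr.
by rewrite -mulrBl; apply: tsidealMr.
Qed.

End Ideals.

Section QuotientRing.
Variables (R : pzRingType) (I : tsideal R).

Definition tsideal_pred : {pred R} := fun x => `[< I x >].

Fact tsideal_pred_closed : zmod_closed tsideal_pred.
Proof.
split; first exact/asboolP/tsideal0.
by move=> x y /asboolP Ix /asboolP Iy; apply/asboolP/tsidealB.
Qed.

HB.instance Definition _ :=
  GRing.isZmodClosed.Build R tsideal_pred tsideal_pred_closed.

Definition quotring := Quotient.quot tsideal_pred.

HB.instance Definition _ := Choice.on quotring.
HB.instance Definition _ := GRing.Zmodule.on quotring.
HB.instance Definition _ := EqQuotient.on quotring.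

Definition quotring_pi (x : R) : quotring := \pi_quotring x.

Definition quotring_mul (x y : quotring) : quotring :=
  quotring_pi (repr x * repr y).

Fact quotring_reprK (x : quotring) : quotring_pi (repr x) = x.
Proof. exact: reprK. Qed.

Fact quotring_mulE (x y : R) :
  quotring_mul (quotring_pi x) (quotring_pi y) = quotring_pi (x * y).
Proof.
have Hr (z : R) : I (repr (quotring_pi z) - z).
  by apply/asboolP; rewrite -[`[< _ >]]/(_ \in tsideal_pred)
    Quotient.idealrBE reprK.
apply/eqP; rewrite -Quotient.idealrBE; apply/asboolP.
set x' := repr _; set y' := repr _.
have -> : x' * y' - x * y = x' * (y' - y) - (x - x') * y.
  by rewrite mulrBr mulrBl opprB addrA addrNK.
apply: tsidealB; first by apply: tsidealMl; apply: Hr.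
apply: tsidealMr; rewrite -opprB -sub0r; apply: tsidealB; first exact: tsideal0.
exact: Hr.
Qed.

Fact quotring_piD (x y : R) :
  quotring_pi (x + y) = quotring_pi x + quotring_pi y.
Proof. exact: (raddfD \pi_(Quotient.quot tsideal_pred)). Qed.

Fact quotring_mulA : associative quotring_mul.
Proof.
move=> x y z; rewrite -[x]quotring_reprK -[y]quotring_reprK -[z]quotring_reprK.
by rewrite (quotring_mulE (repr y)) (quotring_mulE (repr x) (repr y))
  quotring_mulE (quotring_mulE _ (repr z)) mulrA.
Qed.

Fact quotring_mul1 : left_id (quotring_pi 1) quotring_mul.
Proof. by move=> x; rewrite -[x]quotring_reprK quotring_mulE mul1r. Qed.

Fact quotring_mulr1 : right_id (quotring_pi 1) quotring_mul.
Proof. by move=> x; rewrite -[x]quotring_reprK quotring_mulE mulr1. Qed.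

Fact quotring_mulDl : left_distributive quotring_mul +%R.
Proof.
move=> x y z; rewrite -[x]quotring_reprK -[y]quotring_reprK -[z]quotring_reprK.
by rewrite -quotring_piD (quotring_mulE (repr x) (repr z))
  (quotring_mulE (repr y)) quotring_mulE mulrDl quotring_piD.
Qed.

Fact quotring_mulDr : right_distributive quotring_mul +%R.
Proof.
move=> x y z; rewrite -[x]quotring_reprK -[y]quotring_reprK -[z]quotring_reprK.
by rewrite -quotring_piD (quotring_mulE (repr x) (repr y))
  (quotring_mulE (repr x) (repr z)) quotring_mulE mulrDr quotring_piD.
Qed.

HB.instance Definition _ := GRing.Zmodule_isPzRing.Build quotring
  quotring_mulA quotring_mul1 quotring_mulr1 quotring_mulDl quotring_mulDr.

Fact quotring_pi_additive : zmod_morphism quotring_pi.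
Proof. exact: (raddfB \pi_(Quotient.quot tsideal_pred)). Qed.

HB.instance Definition _ :=
  GRing.isZmodMorphism.Build R quotring quotring_pi quotring_pi_additive.

Fact quotring_pi_multiplicative : monoid_morphism quotring_pi.
Proof. by split=> // x y; rewrite -[LHS]quotring_mulE. Qed.

HB.instance Definition _ :=
  GRing.isMonoidMorphism.Build R quotring quotring_pi quotring_pi_multiplicative.

End QuotientRing.

Definition restrict (K R : pzRingType) (f : {rmorphism K -> R})
  (M : lmodType R) : Type := M.

Section Restrict.
Variables (K R : pzRingType) (f : {rmorphism K -> R}) (M : lmodType R).

HB.instance Definition _ := GRing.Zmodule.on (restrict f M).

Definition restrict_scale (c : K) (x : restrict f M) : restrict f M :=
  f c *: (x : M).

Fact restrict_scaleA a b x :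
  restrict_scale a (restrict_scale b x) = restrict_scale (a * b) x.
Proof. by rewrite /restrict_scale scalerA rmorphM. Qed.

Fact restrict_scale1 : left_id 1 restrict_scale.
Proof. by move=> x; rewrite /restrict_scale rmorph1 scale1r. Qed.

Fact restrict_scaleDr : right_distributive restrict_scale +%R.
Proof. by move=> c x y; rewrite /restrict_scale -scalerDr. Qed.

Fact restrict_scaleDl x : {morph restrict_scale^~ x : a b / a + b}.
Proof. by move=> a b; rewrite /restrict_scale rmorphD scalerDl. Qed.

HB.instance Definition _ := GRing.Zmodule_isLmodule.Build K (restrict f M)
  restrict_scaleA restrict_scale1 restrict_scaleDr restrict_scaleDl.

End Restrict.

Record quiver := Quiver {
  vert : finType;
  arr : finType;
  hd : arr -> vert;
  tl : arr -> vert }.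

Definition loop_free (Q : quiver) := forall a : arr Q, hd a <> tl a.

Definition no_2cycle_at (Q : quiver) (k : vert Q) :=
  forall a b : arr Q, hd a = k -> tl b = k -> hd b <> tl a.

(* [wfp i [:: c1; ..; cd]] : the arrows [c1 .. cd] form a path with head [i];
   paths compose as functions, so [cd] is the first arrow travelled. *)
Fixpoint wfp (Q : quiver) (i : vert Q) (s : seq (arr Q)) : bool :=
  if s is c :: s' then (hd c == i) && wfp (tl c) s' else true.

Definition ptl (Q : quiver) (i : vert Q) (s : seq (arr Q)) : vert Q :=
  last i (map (@tl Q) s).

Record qpath (Q : quiver) := QPath {
  pdata :> vert Q * seq (arr Q);
  pdata_wf : wfp pdata.1 pdata.2 }.

HB.instance Definition _ (Q : quiver) := [isSub for @pdata Q].
HB.instance Definition _ (Q : quiver) := [Choice of qpath Q by <:].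

Definition phd (Q : quiver) (p : qpath Q) : vert Q := (val p).1.
Definition parr (Q : quiver) (p : qpath Q) : seq (arr Q) := (val p).2.

Definition cyclic_path (Q : quiver) (p : qpath Q) := ptl (phd p) (parr p) == phd p.

(* A possibly infinite combination of paths is the family of its coefficients. *)
Definition cpa (K : fieldType) (Q : quiver) : Type := qpath Q -> K.

Section PathAlgebra.
Variables (K : fieldType) (Q : quiver).
Local Notation A := (cpa K Q).
Implicit Types (u v w : A) (i j : vert Q) (s : seq (arr Q)).

HB.instance Definition _ := GRing.Zmodule.on A.

(* coefficient of the sequence [s] with head [i], zero if it is not a path *)
Definition coef u i s : K := if insub (i, s) is Some q then u q else 0.

Definition cpa_mul u v : A := fun q =>
  \sum_(n < (size (parr q)).+1)
    coef u (phd q) (take n (parr q))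
    * coef v (ptl (phd q) (take n (parr q))) (drop n (parr q)).

Definition cpa_one : A := fun q => (parr q == [::])%:R.

Definition cpa_scale (c : K) u : A := fun q => c * u q.

Lemma coef_qpath u (q : qpath Q) : coef u (phd q) (parr q) = u q.
Proof. by rewrite /coef -surjective_pairing valK. Qed.

Lemma coef_nwf u i s : ~~ wfp i s -> coef u i s = 0.
Proof. by move=> wf; rewrite /coef insubN. Qed.

Lemma coef_inj u v : (forall i s, coef u i s = coef v i s) -> u = v.
Proof. by move=> uv; apply/funext => q; rewrite -!coef_qpath uv. Qed.

Lemma wfp_cat i s1 s2 : wfp i (s1 ++ s2) = wfp i s1 && wfp (ptl i s1) s2.
Proof. by elim: s1 i => //= c s1 IH i; rewrite IH andbA. Qed.

Lemma cpa_coefD u v i s : coef (u + v) i s = coef u i s + coef v i s.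
Proof. by rewrite /coef; case: insub => [q|] //=; rewrite addr0. Qed.

Lemma cpa_coefN u i s : coef (- u) i s = - coef u i s.
Proof. by rewrite /coef; case: insub => [q|] //=; rewrite oppr0. Qed.

Lemma cpa_coef0 i s : coef 0 i s = 0.
Proof. by rewrite /coef; case: insub. Qed.

Lemma cpa_coefZ c u i s : coef (cpa_scale c u) i s = c * coef u i s.
Proof. by rewrite /coef; case: insub => [q|] //=; rewrite mulr0. Qed.

Lemma cpa_coef1 i s : coef cpa_one i s = (s == [::])%:R.
Proof.
rewrite /coef; case: insubP => [q _ E|]; first by rewrite /cpa_one /parr E.
by case: s => //= c s _; rewrite eqxx.
Qed.

Let F := vert Q -> seq (arr Q) -> K.
Let conv (f g : F) : F := fun i s =>
  \sum_(n < (size s).+1) f i (take n s) * g (ptl i (take n s)) (drop n s).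

Lemma cpa_coefM u v i s : coef (cpa_mul u v) i s = conv (coef u) (coef v) i s.
Proof.
rewrite {1}/coef; case: insubP => [q _ E|wf].
  by rewrite /cpa_mul /phd /parr E.
rewrite /conv big1 // => n _.
have : ~~ wfp i (take n s ++ drop n s) by rewrite cat_take_drop.
rewrite wfp_cat negb_and => /orP[] /coef_nwf ->; by rewrite ?mul0r ?mulr0.
Qed.

Let conv_nil f g i : conv f g i [::] = f i [::] * g i [::].
Proof. by rewrite /conv big_ord_recl big_ord0 addr0. Qed.

Let conv_cons f g i c s : conv f g i (c :: s) =
  f i [::] * g i (c :: s) + conv (fun _ t => f i (c :: t)) g (tl c) s.
Proof. by rewrite /conv big_ord_recl. Qed.

Let convDl f1 f2 g i s :
  conv (fun j t => f1 j t + f2 j t) g i s = conv f1 g i s + conv f2 g i s.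
Proof.
by rewrite /conv -big_split; apply: eq_bigr => n _; rewrite mulrDl.
Qed.

Let convZl c f g i s : conv (fun j t => c * f j t) g i s = c * conv f g i s.
Proof.
by rewrite /conv mulr_sumr; apply: eq_bigr => n _; rewrite mulrA.
Qed.

Let eq_conv f1 f2 g i s : (forall n, f1 i (take n s) = f2 i (take n s)) ->
  conv f1 g i s = conv f2 g i s.
Proof. by move=> E; apply: eq_bigr => n _; rewrite E. Qed.

Let convA f g h i s : conv f (conv g h) i s = conv (conv f g) h i s.
Proof.
elim: s i f g => [|c s IH] i f g; first by rewrite !conv_nil mulrA.
pose f' := fun (_ : vert Q) t => f i (c :: t).
pose g' := fun (_ : vert Q) t => g i (c :: t).
have -> : conv f (conv g h) i (c :: s) = f i [::] * g i [::] * h i (c :: s) +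
    (f i [::] * conv g' h (tl c) s + conv (conv f' g) h (tl c) s).
  by rewrite conv_cons IH (conv_cons g) mulrDr mulrA addrA.
rewrite conv_cons conv_nil; congr (_ + _).
rewrite -convZl -convDl; apply: eq_bigr => n _; congr (_ * _).
by rewrite conv_cons.
Qed.

Fact cpa_mulA : associative cpa_mul.
Proof.
move=> u v w; apply: coef_inj => i s; rewrite !cpa_coefM.
have E x y : coef (cpa_mul x y) = conv (coef x) (coef y).
  by apply/funext => j; apply/funext => t; rewrite cpa_coefM.
by rewrite !E convA.
Qed.

Fact cpa_mul1 : left_id cpa_one cpa_mul.
Proof.
move=> u; apply: coef_inj => i s; rewrite cpa_coefM /conv big_ord_recl cpa_coef1 take0.
rewrite eqxx mul1r drop0 big1 ?addr0 // => n _; rewrite cpa_coef1.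
by case: s n => [[]|c s n] //=; rewrite mul0r.
Qed.

Fact cpa_mulr1 : right_id cpa_one cpa_mul.
Proof.
move=> u; apply: coef_inj => i s; rewrite cpa_coefM /conv big_ord_recr cpa_coef1.
rewrite drop_size take_size eqxx mulr1 big1 => [|n _]; first exact: add0r.
rewrite cpa_coef1; by rewrite /= -size_eq0 size_drop subn_eq0 leqNgt ltn_ord mulr0.
Qed.

Fact cpa_mulDl : left_distributive cpa_mul +%R.
Proof.
move=> u v w; apply: coef_inj => i s; rewrite cpa_coefD !cpa_coefM -convDl.
by apply: eq_conv => n; rewrite cpa_coefD.
Qed.

Fact cpa_mulDr : right_distributive cpa_mul +%R.
Proof.
move=> u v w; apply: coef_inj => i s; rewrite cpa_coefD !cpa_coefM /conv -big_split.
by apply: eq_bigr => n _; rewrite cpa_coefD mulrDr.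
Qed.

HB.instance Definition _ := GRing.Zmodule_isPzRing.Build A
  cpa_mulA cpa_mul1 cpa_mulr1 cpa_mulDl cpa_mulDr.

Fact cpa_scaleA a b u : cpa_scale a (cpa_scale b u) = cpa_scale (a * b) u.
Proof. by apply: coef_inj => i s; rewrite !cpa_coefZ mulrA. Qed.

Fact cpa_scale1 : left_id 1 cpa_scale.
Proof. by move=> u; apply: coef_inj => i s; rewrite !cpa_coefZ mul1r. Qed.

Fact cpa_scaleDr : right_distributive cpa_scale +%R.
Proof. by move=> c u v; apply: coef_inj => i s; rewrite !(cpa_coefZ, cpa_coefD) mulrDr. Qed.

Fact cpa_scaleDl u : {morph cpa_scale^~ u : a b / a + b}.
Proof. by move=> a b; apply: coef_inj => i s; rewrite !(cpa_coefZ, cpa_coefD) mulrDl. Qed.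

HB.instance Definition _ := GRing.Zmodule_isLmodule.Build K A
  cpa_scaleA cpa_scale1 cpa_scaleDr cpa_scaleDl.

Lemma cpa_scaleAl (c : K) u v : c *: (u * v) = (c *: u) * v.
Proof.
apply: coef_inj => i s; rewrite cpa_coefZ !cpa_coefM -convZl.
by apply: eq_conv => n; rewrite cpa_coefZ.
Qed.

Lemma cpa_scaleAr (c : K) u v : c *: (u * v) = u * (c *: v).
Proof.
apply: coef_inj => i s; rewrite cpa_coefZ !cpa_coefM big_distrr.
by apply: eq_bigr => n _; rewrite cpa_coefZ /= mulrCA.
Qed.

Definition cpa_const (c : K) : A := c *: (1 : A).

Fact cpa_const_additive : zmod_morphism cpa_const.
Proof. by move=> a b; rewrite /cpa_const scalerBl. Qed.

HB.instance Definition _ :=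
  GRing.isZmodMorphism.Build K A cpa_const cpa_const_additive.

Fact cpa_const_multiplicative : monoid_morphism cpa_const.
Proof.
split; first by rewrite /cpa_const scale1r.
by move=> a b; rewrite /cpa_const -cpa_scaleAl mul1r scalerA.
Qed.

HB.instance Definition _ :=
  GRing.isMonoidMorphism.Build K A cpa_const cpa_const_multiplicative.

(* the path with head [i] and arrows [s], zero if these do not form a path *)
Definition path_elt i s : A := fun q => (val q == (i, s))%:R.

Definition idem j : A := path_elt j [::].

Definition arrow_elt (a : arr Q) : A := path_elt (hd a) [:: a].

Definition max_ideal : tsideal A := ideal_gen (range arrow_elt).

(* The linear and continuous extension of a map [f] defined on paths: [f] is
   applied only when, for each [q], finitely many [p] have [f p q != 0]. *)
Definition cont_ext (Q' : quiver) (f : qpath Q -> cpa K Q') (u : A) : cpa K Q' :=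
  fun q => \sum_(p \in [set: qpath Q]) u p * f p q.

Definition is_potential (S : A) :=
  forall p, S p != 0 -> cyclic_path p && (parr p != [::]).

Definition cyc_equiv (S S' : A) := adic_closure max_ideal (lin_span
  [set x | exists2 p : qpath Q, cyclic_path p &
     exists c s, parr p = c :: s /\
       x = path_elt (phd p) (c :: s) - path_elt (tl c) (rcons s c)]) (S - S').

(* For a word [w] ending with [a], the sum of the paths [c_{i+l} .. c_d c_1 ..
   c_{i-1}] (with head [tl a]) over the [i] where [w = c_i .. c_{i+l-1}],
   indices being taken modulo [d]. *)
Definition word_deriv (w : seq (arr Q)) (a : arr Q) (p : qpath Q) : A :=
  \sum_(n < size (parr p) | take (size w) (rot n (parr p)) == w)
     path_elt (tl a) (drop (size w) (rot n (parr p))).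

Definition cyc_deriv (a : arr Q) : A -> A := cont_ext (word_deriv [:: a] a).

Definition cyc_deriv2 (b a : arr Q) : A -> A :=
  cont_ext (word_deriv [:: b; a] a).

Definition jacobian (S : A) : tsideal A :=
  adic_closure_ideal max_ideal (ideal_gen (range (fun a => cyc_deriv a S))).

Definition jalg (S : A) : pzRingType := quotring (jacobian S).

End PathAlgebra.

Section Premutation.
Variables (Q : quiver) (k : vert Q).

Definition arrow_in := {a : arr Q | hd a == k}.
Definition arrow_out := {b : arr Q | tl b == k}.
Definition arrow_off := {c : arr Q | (hd c != k) && (tl c != k)}.
Definition arrow_at := {c : arr Q | (hd c == k) || (tl c == k)}.

HB.instance Definition _ := Finite.on arrow_in.
HB.instance Definition _ := Finite.on arrow_out.
HB.instance Definition _ := Finite.on arrow_off.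
HB.instance Definition _ := Finite.on arrow_at.

(* [Comp b a] is the arrow [[ba]] and [Star c] is the arrow [c^*] *)
Inductive mut_arr :=
| Keep of arrow_off
| Comp of arrow_out & arrow_in
| Star of arrow_at.

Definition mut_arr_enc (x : mut_arr) :
    (arrow_off + arrow_out * arrow_in + arrow_at)%type :=
  match x with
  | Keep c => inl (inl c)
  | Comp b a => inl (inr (b, a))
  | Star c => inr c
  end.

Definition mut_arr_dec (x : (arrow_off + arrow_out * arrow_in + arrow_at)%type) :
    mut_arr :=
  match x with
  | inl (inl c) => Keep c
  | inl (inr (b, a)) => Comp b a
  | inr c => Star c
  end.

Fact mut_arr_encK : cancel mut_arr_enc mut_arr_dec.
Proof. by case. Qed.

HB.instance Definition _ := Finite.copy mut_arr (can_type mut_arr_encK).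

Definition mut_hd (x : mut_arr) : vert Q :=
  match x with
  | Keep c => hd (val c)
  | Comp b _ => hd (val b)
  | Star c => tl (val c)
  end.

Definition mut_tl (x : mut_arr) : vert Q :=
  match x with
  | Keep c => tl (val c)
  | Comp _ a => tl (val a)
  | Star c => hd (val c)
  end.

Definition mut : quiver := @Quiver (vert Q) mut_arr mut_hd mut_tl.

Fact arrow_in_at (a : arrow_in) : (hd (val a) == k) || (tl (val a) == k).
Proof. by rewrite (valP a). Qed.

Fact arrow_out_at (b : arrow_out) : (hd (val b) == k) || (tl (val b) == k).
Proof. by rewrite (valP b) orbT. Qed.

Definition star_in (a : arrow_in) : arr mut := Star (exist _ (val a) (arrow_in_at a)).
Definition star_out (b : arrow_out) : arr mut :=
  Star (exist _ (val b) (arrow_out_at b)).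

Definition del : quiver :=
  @Quiver {j : vert Q | j != k} arrow_off
    (fun c => exist _ (hd (val c)) (proj1 (andP (valP c))))
    (fun c => exist _ (tl (val c)) (proj2 (andP (valP c)))).

Definition is_star (x : mut_arr) : bool := if x is Star _ then true else false.

Definition unbracket (s : seq mut_arr) : seq (arr Q) :=
  flatten [seq match x with
               | Keep c => [:: val c]
               | Comp b a => [:: val b; val a]
               | Star _ => [::]
               end | x <- s].

Variable K : fieldType.

(* Replacing each occurrence of [ba] by [[ba]] maps the paths of [Q] that neither
   start nor end at [k] bijectively onto the paths of [mut] without starred
   arrows and not reduced to [e_k]; the inverse bijection is [unbracket].  Hence
   the coefficient of [bracket u] at [q] is that of [u] at [unbracket q]. *)
Definition bracket (u : cpa K Q) : cpa K mut := fun q =>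
  if has is_star (parr q) then 0 else coef u (phd q) (unbracket (parr q)).

(* for [S] none of whose cycles starts at [k] *)
Definition mut_potential (S : cpa K Q) : cpa K mut :=
  bracket S + \sum_(b : arrow_out) \sum_(a : arrow_in)
    @path_elt K mut k [:: star_out b; Comp b a; star_in a].

Definition no_cycle_at (S : cpa K Q) := forall p, S p != 0 -> phd p != k.

End Premutation.

Section KappaPsi.
Variables (K : fieldType) (Q : quiver) (k : vert Q) (S : cpa K Q).

Definition mut2 : quiver := mut (k : vert (mut k)).
Definition hat_mut2 : quiver := @del mut2 k.

(* on [e_k^ K<<mut k>> e_k^]; every arrow of [hat_mut2] avoids [k], hence is not
   starred in [mut2], so that [kappa] is the restriction of [bracket] *)
Definition kappa (u : cpa K (mut k)) : cpa K hat_mut2 := fun q =>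
  coef (@bracket (mut k) k K u) (val (phd q)) (map val (parr q)).

(* The value [0] is never taken when [Q] is loop-free: the arrows of [mut2]
   avoiding [k] are not starred, and the arrows of [mut k] incident to [k] are
   starred.  An arrow [Comp y x] of [mut2] is [[a^*b^*]] for [y = a^*],
   [x = b^*]. *)
Definition psi_arrow (x : arr hat_mut2) : cpa K Q :=
  match val x : mut_arr (k : vert (mut k)) with
  | Keep y =>
      match val y : mut_arr k with
      | Keep c => arrow_elt K (val c)
      | Comp b a => arrow_elt K (val b) * arrow_elt K (val a)
      | Star _ => 0
      end
  | Comp y x =>
      match val y : mut_arr k, val x : mut_arr k with
      | Star a, Star b => - cyc_deriv2 (val b) (val a) S
      | _, _ => 0
      end
  | Star _ => 0
  end.

Definition psi_path (p : qpath hat_mut2) : cpa K Q :=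
  @idem K Q (val (phd p)) * \prod_(x <- parr p) psi_arrow x.

Definition psi : cpa K hat_mut2 -> cpa K Q := cont_ext psi_path.

End KappaPsi.

Section DiagonalScalars.
Variables (K : fieldType) (I : finType).

Definition ffun_const (c : K) : {ffun I -> K} := [ffun => c].

Fact ffun_const_additive : zmod_morphism ffun_const.
Proof. by move=> a b; apply/ffunP => i; rewrite !ffunE. Qed.

HB.instance Definition _ :=
  GRing.isZmodMorphism.Build K {ffun I -> K} ffun_const ffun_const_additive.

Fact ffun_const_multiplicative : monoid_morphism ffun_const.
Proof. by split=> [|a b]; apply/ffunP => i; rewrite !ffunE. Qed.

HB.instance Definition _ :=
  GRing.isMonoidMorphism.Build K {ffun I -> K} ffun_const
    ffun_const_multiplicative.

End DiagonalScalars.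

Section Triangle.
Variables (K : fieldType) (Q : quiver) (S : cpa K Q) (k : vert Q).
Variables (M : lmodType (jalg S)) (V : lmodType {ffun vert Q -> K}).

Definition kmod : lmodType K := restrict (@quotring_pi _ (jacobian S) \o @cpa_const K Q) M.

Definition act (u : cpa K Q) (m : kmod) : kmod :=
  (quotring_pi (jacobian S) u : jalg S) *: (m : M).

Fact act_linear u : linear (act u).
Proof.
move=> c x y; rewrite /act scalerDr; congr (_ + _).
pose pi := quotring_pi (jacobian S).
change (pi u *: (pi (cpa_const c) *: (x : M)) =
        pi (cpa_const c) *: (pi u *: (x : M))).
rewrite !scalerA -!rmorphM; congr (pi _ *: _).
by rewrite /cpa_const -cpa_scaleAr -cpa_scaleAl mulr1 mul1r.
Qed.

HB.instance Definition _ u := GRing.isLinear.Build K kmod kmod *:%R (act u)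
  (act_linear u).

Definition Mvert (j : vert Q) : subspace kmod := imagesp (act (idem K j)) (fullsp kmod).

Definition Mhat : subspace kmod := imagesp (act (1 - idem K k)) (fullsp kmod).

Definition Vspace : lmodType K := restrict (@ffun_const K (vert Q)) V.

Definition Videm (v : Vspace) : Vspace :=
  ([ffun j => (j == k)%:R] : {ffun vert Q -> K}) *: (v : V).

Fact Videm_linear : linear Videm.
Proof.
move=> c x y; rewrite /Videm scalerDr; congr (_ + _).
pose e : {ffun vert Q -> K} := [ffun j => (j == k)%:R].
change (e *: (ffun_const (vert Q) c *: (x : V)) =
        ffun_const (vert Q) c *: (e *: (x : V))).
rewrite !scalerA; congr (_ *: _).
by apply/ffunP => j; rewrite !ffunE mulrC.
Qed.

HB.instance Definition _ := GRing.isLinear.Build K Vspace Vspace *:%R Videm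
  Videm_linear.

Definition Vk : subspace Vspace := imagesp Videm (fullsp Vspace).

Notation In := (arrow_in k).
Notation Out := (arrow_out k).

Definition Min : subspace {ffun In -> kmod} :=
  dirsum (fun a : In => Mvert (tl (val a))).

Definition Mout : subspace {ffun Out -> kmod} :=
  dirsum (fun b : Out => Mvert (hd (val b))).

(* [alpha : Min -> M_k], [beta : M_k -> Mout] and [gamma : Mout -> Min] are given
   here on the ambient spaces, and restricted when kernels and images are taken. *)
Definition alpha (x : {ffun In -> kmod}) : kmod :=
  \sum_(a : In) act (arrow_elt K (val a)) (x a).

Definition beta (m : kmod) : {ffun Out -> kmod} :=
  [ffun b : Out => act (arrow_elt K (val b)) m].

Definition gamma (y : {ffun Out -> kmod}) : {ffun In -> kmod} :=
  [ffun a : In => \sum_(b : Out) act (cyc_deriv2 (val b) (val a) S) (y b)].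

Fact alpha_linear : linear alpha.
Proof.
move=> c x y; rewrite /alpha scaler_sumr -big_split; apply: eq_bigr => a _.
by rewrite !ffunE linearP.
Qed.

Fact beta_linear : linear beta.
Proof. by move=> c x y; apply/ffunP => b; rewrite !ffunE linearP. Qed.

Fact gamma_linear : linear gamma.
Proof.
move=> c x y; apply/ffunP => a; rewrite !ffunE scaler_sumr -big_split.
by apply: eq_bigr => b _; rewrite !ffunE linearP.
Qed.

HB.instance Definition _ := GRing.isLinear.Build K {ffun In -> kmod} kmod *:%R
  alpha alpha_linear.
HB.instance Definition _ := GRing.isLinear.Build K kmod {ffun Out -> kmod} *:%R
  beta beta_linear.
HB.instance Definition _ := GRing.isLinear.Build K {ffun Out -> kmod}
  {ffun In -> kmod} *:%R gamma gamma_linear.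

Definition ker_alpha := kersp alpha Min.
Definition im_beta := imagesp beta (Mvert k).
Definition ker_gamma := kersp gamma Mout.
Definition im_gamma := imagesp gamma Mout.

Definition ker_gamma_mod_im_beta := subquot ker_gamma im_beta.
Definition ker_alpha_mod_im_gamma := subquot ker_alpha im_gamma.
Definition coker_beta := subquot Mout im_beta.

Definition is_retraction (rho : subsp Mout -> subsp ker_gamma) :=
  forall y : subsp Mout, ker_gamma (val y) -> val (rho y) = val y.

Definition is_section (sigma : ker_alpha_mod_im_gamma -> subsp ker_alpha) :=
  forall x, quotsp_pi (subsp_in ker_alpha im_gamma) (sigma x) = x.

Section Descriptions.
Variables (rho : subsp Mout -> subsp ker_gamma).
Variables (sigma : ker_alpha_mod_im_gamma -> subsp ker_alpha).

(* The elements to which [in_subsp] is applied lie in the relevant subspace because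
   [alpha \o gamma = 0] on [Mout] and because [gamma] maps [Mout] to [Min]. *)
Let pr : subsp ker_gamma -> ker_gamma_mod_im_beta := quotsp_pi _.

Definition MbarA : lmodType K :=
  (ker_gamma_mod_im_beta * subsp im_gamma * ker_alpha_mod_im_gamma * subsp Vk)%type.

Definition alphabarA (y : subsp Mout) : MbarA :=
  (- pr (rho y), in_subsp im_gamma (- gamma (val y)), 0, 0).

Definition betabarA (w : MbarA) : subsp Min :=
  let: (_, w2, w3, _) := w in in_subsp Min (val w2 + val (sigma w3)).

Definition MbarB : lmodType K :=
  (ker_gamma_mod_im_beta * subsp ker_alpha * subsp Vk)%type.

Definition alphabarB (y : subsp Mout) : MbarB :=
  (- pr (rho y), in_subsp ker_alpha (- gamma (val y)), 0).

Definition betabarB (w : MbarB) : subsp Min :=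
  let: (_, w2, _) := w in in_subsp Min (val w2).

Definition MbarC : lmodType K :=
  (coker_beta * ker_alpha_mod_im_gamma * subsp Vk)%type.

Definition alphabarC (y : subsp Mout) : MbarC :=
  (- quotsp_pi (subsp_in Mout im_beta) y, 0, 0).

(* [gamma] induces a map on [coker_beta] since [gamma \o beta = 0], so the choice
   of the representative is immaterial *)
Definition gammabar (w : coker_beta) : {ffun In -> kmod} := gamma (val (repr w)).

Definition betabarC (w : MbarC) : subsp Min :=
  let: (w1, w2, _) := w in in_subsp Min (gammabar w1 + val (sigma w2)).

End Descriptions.

Section Action.
Variables (Mk : lmodType K).
Variables (alphabar : subsp Mout -> Mk) (betabar : Mk -> subsp Min).

(* [Mhat] is [e_k^ M], that is, the direct sum of the [M_j] for [j != k]. *)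
Definition Mbar : lmodType K := (subsp Mhat * Mk)%type.

Local Notation A := (cpa K (mut k)).

Definition inj_out (b : Out) (m : kmod) : {ffun Out -> kmod} :=
  [ffun b' => if b' == b then m else 0].

Definition eta_idem (z : K) (x : Mbar) : Mbar := (0, z *: x.2).

(* [M_{t(a)}] is contained in [e_k^ M] when [Q] is loop-free *)
Definition eta_star_in (a : In) (x : Mbar) : Mbar :=
  (in_subsp Mhat (val (betabar x.2) a), 0).

Definition eta_star_out (b : Out) (x : Mbar) : Mbar :=
  (0, alphabar (in_subsp Mout
        (inj_out b (act (idem K (hd (val b))) (val x.1))))).

(* on [e_k^ K<<mut k>> e_k^], where [psi (kappa u)] lies in [e_k^ K<<Q>> e_k^] *)
Definition Theta (u : A) (x : Mbar) : Mbar :=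
  (in_subsp Mhat (act (psi S (kappa u)) (val x.1)), 0).

(* The components of [u = z e_k + u_k^ + \sum_a v_a a^* + \sum_b b^* w_b
   + \sum_(b, a) b^* x_(b, a) a^*]. *)
Definition comp_z (u : A) : K := coef u k [::].

Definition comp_hat (u : A) : A :=
  (1 - @idem K (mut k) k) * u * (1 - @idem K (mut k) k).

Definition comp_v (u : A) (a : In) : A := fun q =>
  if phd q == k then 0 else coef u (phd q) (rcons (parr q) (star_in a)).

Definition comp_w (u : A) (b : Out) : A := fun q =>
  if ptl (phd q) (parr q) == k then 0 else coef u k (star_out b :: parr q).

Definition comp_x (u : A) (b : Out) (a : In) : A := fun q =>
  coef u k (star_out b :: rcons (parr q) (star_in a)).

Definition eta_tilde (u : A) (x : Mbar) : Mbar :=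
  eta_idem (comp_z u) x
  + Theta (comp_hat u) x
  + \sum_(a : In) Theta (comp_v u a) (eta_star_in a x)
  + \sum_(b : Out) eta_star_out b (Theta (comp_w u b) x)
  + \sum_(b : Out) \sum_(a : In)
      eta_star_out b (Theta (comp_x u b a) (eta_star_in a x)).

End Action.

Definition eta_tildeA rho sigma := eta_tilde (alphabarA rho) (betabarA sigma).
Definition eta_tildeB rho := eta_tilde (alphabarB rho) betabarB.
Definition eta_tildeC sigma := eta_tilde alphabarC (betabarC sigma).

End Triangle.

Arguments mut_potential {Q} k {K} S.
Arguments eta_tildeA {K Q S k M} V rho sigma.
Arguments eta_tildeB {K Q S k M} V rho.
Arguments eta_tildeC {K Q S k M} V sigma.

Definition annihilates (A : Type) (W : zmodType) (J : A -> Prop)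
    (rep : A -> W -> W) :=
  forall u, J u -> forall x, rep u x = 0.

(* Main.v *)
(* Let F be the map psi kappa of the context.  It is not multiplicative on the whole
   of K<<mut k>>: splitting a path at an occurrence of a^* b^* gives
     F (x y) = F x F y - sum_(a, b) F (x / a^* ) d_ba(S) F (b^* \ y),
   where x / a^* and b^* \ y are right and left quotients.  Up to the term of u at e_k,
   an element u acts on Mbar by the matrix with entries
     F u, F (u / a^* ), F (b^* \ u), F (b^* \ u / a^* ),
   and it acts by zero if that term is zero and this matrix has the form
   beta P + C alpha modulo J(S), because alphabar beta = 0 and alpha betabar = 0.  As alpha gamma and gamma beta vanish
   modulo J(S), such elements u form an ideal.  It contains the cyclic derivatives of
   the premutated potential, and it is closed: given solutions P, C modulo every power
   of the maximal ideal, linear compactness yields exact ones.  (M need not be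
   nilpotent, so continuity of the action is not available.) *)

From HB Require Import structures.
Require Import Defs.
From mathcomp Require Import all_boot all_order all_algebra.
From mathcomp Require Import boolp classical_sets functions cardinality fsbigop.

Set Implicit Arguments.
Unset Strict Implicit.
Unset Printing Implicit Defensive.

Import GRing.Theory.
Local Open Scope ring_scope.
Local Open Scope classical_set_scope.

(** * Coefficients and the adic filtration *)

(** The two summands of the matrix condition mirror the two families of starred generators: the
    derivative along [a^*] is the sum of the [b^* [ba]] and has a matrix of the form beta P, the
    derivative along [b^*] is the sum of the [[ba] a^*] and has the form C alpha. The other
    generators have matrix zero modulo J(S). The entries of P and C lie in the Jacobian algebra and
    not in endomorphisms of M, so the ideal depends on Q, S and k only, and the three descriptions
    of the mutated module are treated at once. The difficulty is the closure: the approximants of an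
    element carry their own P and C, which have no reason to converge. For a fixed n, however, the
    pairs solving the equations modulo J(S) and words of length at least n form a nonempty affine
    space, and membership depends on finitely many coefficients. Identities for F are proved by
    recursion on the first letter. This needs second derivatives without constant term, which is
    where the absence of 2-cycles at k enters. The given potential and its representative without
    cycles at k are compared through sums of coefficients over rotations. *)

Section TwoSidedIdeals.
Variables (R : pzRingType) (I : tsideal R).

Lemma tsidealN x : I x -> I (- x).
Proof. by move=> Ix; rewrite -sub0r; apply: tsidealB; first exact: tsideal0. Qed.

Lemma tsidealD x y : I x -> I y -> I (x + y).
Proof. by move=> Ix Iy; rewrite -[y]opprK; apply/tsidealB/tsidealN. Qed.

Lemma tsideal_sum (T : Type) (r : seq T) (P : pred T)
    (f : T -> R) :
  (forall a, P a -> I (f a)) -> I (\sum_(a <- r | P a) f a).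
Proof. by move=> If; apply: big_ind => //; [exact: tsideal0|exact: tsidealD]. Qed.

End TwoSidedIdeals.

Section Coefficients.
Variables (K : fieldType) (Q : quiver).
Local Notation A := (cpa K Q).
Implicit Types (u v x y : A) (i j : vert Q) (s t : seq (arr Q)) (c d : arr Q).

Lemma pa_coefD u v i s : coef (u + v) i s = coef u i s + coef v i s.
Proof. exact: cpa_coefD. Qed.

Lemma pa_coefN u i s : coef (- u) i s = - coef u i s.
Proof. exact: cpa_coefN. Qed.

Lemma pa_coefB u v i s : coef (u - v) i s = coef u i s - coef v i s.
Proof. by rewrite pa_coefD pa_coefN. Qed.

Lemma pa_coef0 i s : coef (0 : A) i s = 0.
Proof. exact: cpa_coef0. Qed.

Lemma pa_coefZ (e : K) u i s : coef (e *: u) i s = e * coef u i s.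
Proof. exact: cpa_coefZ. Qed.

Lemma pa_coef_sum (I : Type) (r : seq I) (P : pred I) (f : I -> A) i s :
  coef (\sum_(n <- r | P n) f n) i s = \sum_(n <- r | P n) coef (f n) i s.
Proof.
by apply: (big_morph (fun u => coef u i s)) => [x y|]; rewrite ?pa_coefD ?pa_coef0.
Qed.

Lemma pa_coefM u v i s : coef (u * v) i s =
  \sum_(n < (size s).+1) coef u i (take n s) * coef v (ptl i (take n s)) (drop n s).
Proof. exact: cpa_coefM. Qed.

(** Reads the coefficients of a series defined by a formula in the head and the word of a path. The
    test is there because [coef] is zero on words that are not paths, whatever [f] does. *)
Lemma coef_fun (f : vert Q -> seq (arr Q) -> K) i s :
  coef (fun q => f (phd q) (parr q)) i s = if wfp i s then f i s else 0.
Proof. by rewrite /coef; case: insubP => [q wf E|/negPf->]; rewrite ?wf /phd /parr ?E. Qed.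

Lemma coef_path_elt j t i s :
  coef (@path_elt K Q j t) i s = (wfp i s && (i == j) && (s == t))%:R.
Proof.
rewrite -[@path_elt K Q j t]/(fun q => (val q == (j, t))%:R).
have -> : (fun q : qpath Q => (val q == (j, t))%:R) =
          (fun q => ((phd q, parr q) == (j, t))%:R :> K).
  by apply/funext => q; rewrite /phd /parr -surjective_pairing.
rewrite (coef_fun (fun i s => ((i, s) == (j, t))%:R)).
by case: wfp; rewrite ?xpair_eqE.
Qed.

Lemma coef_idem j i s : coef (idem K j) i s = ((i == j) && (s == [::]))%:R.
Proof.
by rewrite coef_path_elt; have [->|] := eqVneq s [::]; rewrite ?andbF ?andbT.
Qed.

Lemma coef_arrow c i s :
  coef (arrow_elt K c) i s = ((i == hd c) && (s == [:: c]))%:R.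
Proof.
rewrite coef_path_elt -andbA; case: (s =P [:: c]) => [->|_]; last by rewrite !andbF.
by rewrite /= !andbT [hd c == i]eq_sym andbb.
Qed.

Lemma coef_idemM j x i s : coef (idem K j * x) i s = (i == j)%:R * coef x i s.
Proof.
rewrite pa_coefM big_ord_recl take0 drop0 coef_idem eqxx andbT big1 ?addr0 // => n _.
by rewrite coef_idem; case: s n => [[]|d s n] //=; rewrite andbF mul0r.
Qed.

Lemma coefM_idem j x i s : coef (x * idem K j) i s = (ptl i s == j)%:R * coef x i s.
Proof.
rewrite pa_coefM big_ord_recr take_size drop_size coef_idem eqxx andbT big1 => [|n _].
  by rewrite /= add0r mulrC.
by rewrite coef_idem /= -size_eq0 size_drop subn_eq0 leqNgt ltn_ord andbF mulr0.
Qed.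

Lemma coef_arrowM0 c x i : coef (arrow_elt K c * x) i [::] = 0.
Proof. by rewrite pa_coefM big_ord1 coef_arrow andbF mul0r. Qed.

Lemma coef_arrowM c x i d s :
  coef (arrow_elt K c * x) i (d :: s) = ((i == hd c) && (d == c))%:R * coef x (tl c) s.
Proof.
rewrite pa_coefM big_ord_recl coef_arrow andbF mul0r add0r big_ord_recl big1 => [|n _].
  rewrite addr0 coef_arrow /= take0 drop0 eqseq_cons eqxx andbT.
  by case: andP => [[_ /eqP->]|_]; rewrite ?mul0r.
rewrite coef_arrow; case: s n => [[]|d' s n] //=.
by rewrite eqseq_cons andbF andbF mul0r.
Qed.

Lemma coefM_arrow0 c x i : coef (x * arrow_elt K c) i [::] = 0.
Proof. by rewrite pa_coefM big_ord1 coef_arrow andbF mulr0. Qed.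

Lemma ptl_rcons i s c : ptl i (rcons s c) = tl c.
Proof. by rewrite /ptl map_rcons last_rcons. Qed.

Lemma wfp_rcons i s c : wfp i (rcons s c) = wfp i s && (hd c == ptl i s).
Proof. by rewrite -cats1 wfp_cat /= andbT. Qed.

Lemma coefM_arrow c x i s d : coef (x * arrow_elt K c) i (rcons s d) =
  ((ptl i s == hd c) && (d == c))%:R * coef x i s.
Proof.
rewrite pa_coefM size_rcons 2!big_ord_recr big1 => [|n _] /=.
  rewrite add0r !coef_arrow (@drop_oversize _ (size s).+1) ?size_rcons // andbF mulr0 addr0.
  by rewrite -cats1 take_size_cat // drop_size_cat // eqseq_cons eqxx andbT mulrC.
rewrite coef_arrow [_ == [:: c]]negbTE ?andbF ?mulr0 //.
apply: contraL (ltn_ord n) => /eqP /(congr1 size); rewrite size_drop size_rcons /=.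
by rewrite subSn ?(ltnW (ltn_ord n)) // => -[/eqP]; rewrite subn_eq0 -leqNgt.
Qed.

Lemma idemM j j' : idem K j * idem K j' = (j == j')%:R *: idem K j' :> A.
Proof.
apply: coef_inj => i s; rewrite coef_idemM pa_coefZ !coef_idem.
have [->|] := eqVneq i j'; last by rewrite !mulr0.
by rewrite eq_sym.
Qed.

Lemma idem_arrow j c : idem K j * arrow_elt K c = (j == hd c)%:R *: arrow_elt K c :> A.
Proof.
apply: coef_inj => i s; rewrite coef_idemM pa_coefZ !coef_arrow.
have [->|] := eqVneq i (hd c); last by rewrite mulr0 mulr0.
by rewrite eq_sym.
Qed.

Lemma arrow_idem j c : arrow_elt K c * idem K j = (tl c == j)%:R *: arrow_elt K c :> A.
Proof.
apply: coef_inj => i s; rewrite coefM_idem pa_coefZ !coef_arrow.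
have [->|] := eqVneq s [:: c]; last by rewrite andbF !mulr0.
by [].
Qed.

End Coefficients.

Section Filtration.
Variables (K : fieldType) (Q : quiver).
Local Notation A := (cpa K Q).
Implicit Types (u v x y : A) (i j : vert Q) (s t : seq (arr Q)) (c d : arr Q).

(** This is the n-th power of the arrow ideal, read off coefficients: see [ideal_pow_filt] and
    [filt_ideal_pow]. *)
Definition filt n x := forall i s, (size s < n)%N -> coef x i s = 0.

Lemma filt0 n : filt n 0.
Proof. by move=> i s _; rewrite pa_coef0. Qed.

Lemma filtD n x y : filt n x -> filt n y -> filt n (x + y).
Proof. by move=> fx fy i s ns; rewrite pa_coefD fx ?fy ?addr0. Qed.

Lemma filtN n x : filt n x -> filt n (- x).
Proof. by move=> fx i s ns; rewrite pa_coefN fx ?oppr0. Qed.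

Lemma filtB n x y : filt n x -> filt n y -> filt n (x - y).
Proof. by move=> fx fy; apply/filtD/filtN. Qed.

Lemma filtZ n e x : filt n x -> filt n (e *: x).
Proof. by move=> fx i s ns; rewrite pa_coefZ fx ?mulr0. Qed.

Lemma filt_sum n (I : Type) (r : seq I) (P : pred I) (f : I -> A) :
  (forall a, P a -> filt n (f a)) -> filt n (\sum_(a <- r | P a) f a).
Proof. by move=> ff; apply: big_ind => //; [exact: filt0|exact: filtD]. Qed.

Lemma filt_any x : filt 0 x.
Proof. by []. Qed.

Lemma filtS m n x : (m <= n)%N -> filt n x -> filt m x.
Proof. by move=> mn fx i s sm; apply: fx; apply: leq_trans mn. Qed.

Lemma filtM m n x y : filt m x -> filt n y -> filt (m + n) (x * y).
Proof.
move=> fx fy i s smn; rewrite pa_coefM big1 // => a _.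
have [am|ma] := ltnP (size (take a s)) m; first by rewrite fx ?mul0r.
rewrite fy ?mulr0 // -(ltn_add2l m); apply: leq_ltn_trans smn.
by rewrite -[in leqRHS](cat_take_drop a s) size_cat leq_add2r.
Qed.

Lemma filtMl n x y : filt n y -> filt n (x * y).
Proof. by move=> fy; apply: (filtM (filt_any x)). Qed.

Lemma filtMr n x y : filt n x -> filt n (x * y).
Proof. by move=> fx; rewrite -[n]addn0; apply: filtM. Qed.

Lemma filt_arrow c : filt 1 (arrow_elt K c).
Proof. by move=> i [|d s] // _; rewrite coef_arrow andbF. Qed.

Lemma filt_eq0 x : (forall n, filt n x) -> x = 0.
Proof. by move=> fx; apply: coef_inj => i s; rewrite pa_coef0 (fx (size s).+1). Qed.

(** Left quotient by an arrow; [rd] is the right quotient. The test on the head matters for trivial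
    paths only, since [[:: c]] is a path whatever the vertex of [q]. *)
Definition ld c u : A := fun q => if phd q == tl c then coef u (hd c) (c :: parr q) else 0.

Definition rd c u : A := fun q => coef u (phd q) (rcons (parr q) c).

Lemma coef_ld c u i s :
  coef (ld c u) i s = if i == tl c then coef u (hd c) (c :: s) else 0.
Proof.
rewrite (coef_fun (fun i s => if i == tl c then coef u (hd c) (c :: s) else 0)).
case: ifPn => // nwf; case: eqP => // E.
by rewrite coef_nwf //= eqxx -E.
Qed.

Lemma coef_rd c u i s : coef (rd c u) i s = coef u i (rcons s c).
Proof.
rewrite (coef_fun (fun i s => coef u i (rcons s c))).
by case: ifPn => // nwf; rewrite coef_nwf // wfp_rcons negb_and nwf.
Qed.

Lemma ld_linear c : linear (ld c).
Proof.
move=> e x y; apply: coef_inj => i s; rewrite pa_coefD pa_coefZ !coef_ld pa_coefD pa_coefZ.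
by case: eqP; rewrite ?mulr0 ?addr0.
Qed.

HB.instance Definition _ c := GRing.isLinear.Build K A A *:%R (ld c) (ld_linear c).

Lemma rd_linear c : linear (rd c).
Proof.
by move=> e x y; apply: coef_inj => i s; rewrite pa_coefD pa_coefZ !coef_rd pa_coefD pa_coefZ.
Qed.

HB.instance Definition _ c := GRing.isLinear.Build K A A *:%R (rd c) (rd_linear c).

Lemma filt_ld n c x : filt n.+1 x -> filt n (ld c x).
Proof. by move=> fx i s ns; rewrite coef_ld; case: eqP => // _; rewrite fx. Qed.

Lemma filt_rd n c x : filt n.+1 x -> filt n (rd c x).
Proof. by move=> fx i s ns; rewrite coef_rd fx // size_rcons. Qed.

Lemma ld_rd c d x : ld c (rd d x) = rd d (ld c x).
Proof.
by apply: coef_inj => i s; rewrite coef_ld !coef_rd coef_ld.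
Qed.

(** The first arrow of a product comes from [x], or from [y] when [x] contributes the trivial path
    at [hd c]. *)
Lemma ldM c x y : ld c (x * y) = ld c x * y + coef x (hd c) [::] *: ld c y.
Proof.
apply: coef_inj => i s; rewrite pa_coefD pa_coefZ !coef_ld.
case: eqP => [->|ne]; last first.
  rewrite mulr0 addr0 pa_coefM big1 // => -[[|n] /= ltn] _.
    by rewrite coef_ld take0; case: eqP; rewrite ?mul0r.
  by rewrite coef_ld; case: eqP; rewrite ?mul0r.
rewrite pa_coefM big_ord_recl addrC; congr (_ + _); rewrite pa_coefM.
by apply: eq_bigr => n _; rewrite coef_ld eqxx.
Qed.

Lemma rdM c x y : rd c (x * y) = x * rd c y + coef y (tl c) [::] *: rd c x.
Proof.
apply: coef_inj => i s; rewrite pa_coefD pa_coefZ !coef_rd !pa_coefM size_rcons big_ord_recr.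
rewrite /= take_oversize ?size_rcons // drop_oversize ?size_rcons // ptl_rcons.
rewrite mulrC; congr (_ + _); apply: eq_bigr => -[n /= ltn] _.
rewrite coef_rd -!cats1 takel_cat // drop_cat; move: ltn.
rewrite ltnS leq_eqVlt => /orP[/eqP->|->] //.
by rewrite ltnn subnn drop0 drop_size.
Qed.

Lemma arrow_decomp u :
  u = \sum_j coef u j [::] *: idem K j + \sum_c arrow_elt K c * ld c u.
Proof.
apply: coef_inj => i [|c s]; rewrite pa_coefD !pa_coef_sum.
  rewrite [X in _ + X]big1 ?addr0 => [|d _]; last exact: coef_arrowM0.
  rewrite (bigD1 i) //= pa_coefZ coef_idem !eqxx mulr1 big1 ?addr0 // => j ji.
  by rewrite pa_coefZ coef_idem eq_sym (negPf ji) mulr0.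
rewrite big1 ?add0r => [|j _]; last by rewrite pa_coefZ coef_idem andbF mulr0.
rewrite (bigD1 c) //= coef_arrowM eqxx andbT coef_ld eqxx big1 ?addr0 => [|d dc].
  have [->|ne] := eqVneq i (hd c); first by rewrite mul1r.
  by rewrite mul0r coef_nwf //= eq_sym (negPf ne).
by rewrite coef_arrowM [c == d]eq_sym (negPf dc) andbF mul0r.
Qed.

Lemma max_ideal_filt : max_ideal K Q `<=` filt 1.
Proof.
have I : forall x y, filt 1 x -> filt 1 y -> filt 1 (x - y) by move=> ? ?; exact: filtB.
pose J := @TSIdeal A (filt 1) (@filt0 1) I (fun a x => @filtMl 1 a x)
  (fun a x => @filtMr 1 x a).
by move=> x /(_ J); apply=> _ [c _ <-]; apply: filt_arrow.
Qed.

Lemma ideal_pow_filt n : ideal_pow (max_ideal K Q) n `<=` filt n.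
Proof.
elim: n => [|n IH] //= x.
pose J := @TSIdeal A (filt n.+1) (@filt0 n.+1) (@filtB n.+1) (fun a x => @filtMl n.+1 a x)
  (fun a x => @filtMr n.+1 x a).
move=> /(_ J); apply=> _ [y [z [my mz ->]]].
by apply: (@filtM 1 n); [apply: max_ideal_filt | apply: IH].
Qed.

(** The quiver has finitely many arrows, so splitting off the first arrow writes a series of
    positive order as a finite sum of products of an arrow and a series of order one less. *)
Lemma filt_ideal_pow n : filt n `<=` ideal_pow (max_ideal K Q) n.
Proof.
elim: n => [|n IH] // x fx; rewrite [x]arrow_decomp big1 ?add0r => [|j _].
  apply: tsideal_sum => c _ J; apply; exists (arrow_elt K c), (ld c x); split=> //.
    by move=> I; apply; exists c.
  exact/IH/filt_ld.
by rewrite fx // scale0r.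
Qed.

Lemma jacobian_closed (S : A) x :
  (forall n, exists2 y, jacobian S y & filt n (x - y)) -> jacobian S x.
Proof.
move=> cl.
suff: adic_closure (max_ideal K Q) (ideal_gen (range (fun a => cyc_deriv a S))) x by [].
move=> n; have [y Jy fxy] := cl n; have [z Iz yz] := Jy n.
exists z; first exact: Iz.
have -> : x - z = (x - y) + (y - z) by rewrite addrA subrK.
by apply: tsidealD => //; apply: filt_ideal_pow.
Qed.

End Filtration.

(** * Cyclic derivatives as sums over rotations *)

Section ContinuousExtension.
Variables (K : fieldType) (Q Q' : quiver).
Implicit Types (u v : cpa K Q).

Fixpoint words (n : nat) : seq (seq (arr Q)) :=
  [::] :: if n is m.+1 then [seq c :: s | c <- enum (arr Q), s <- words m] else [::].

Lemma mem_words n s : (s \in words n) = (size s <= n)%N.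
Proof.
elim: n s => [|n IH] [|c s] //=; rewrite in_cons /=.
apply/allpairsP/idP => [[[d t] [_ tn /= [_ ->]]]|sn]; first by rewrite ltnS -IH.
by exists (c, s); rewrite mem_enum IH.
Qed.

Lemma uniq_words n : uniq (words n).
Proof.
elim: n => [|n IH] //=; apply/andP; split.
  by apply/negP => /allpairsP[[c s] /= []].
by apply: allpairs_uniq => //; [exact: enum_uniq | move=> [c s] [d t] _ _ /= [-> ->]].
Qed.

(** Turns the finitely supported sum of [cont_ext] into a plain finite one. Words that are not paths
    may be included, as [coef] vanishes on them. *)
Lemma cont_extE (f : vert Q -> seq (arr Q) -> cpa K Q') u q n :
    (forall i s, f i s q != 0 -> (size s <= n)%N) ->
  cont_ext (fun p => f (phd p) (parr p)) u q =
  \sum_j \sum_(s <- words n) coef u j s * f j s q.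
Proof.
move=> fn; pose r := [seq (j, s) | j <- enum (vert Q), s <- words n].
pose r' : seq (qpath Q) := pmap insub r.
have mem_r j s : ((j, s) \in r) = (size s <= n)%N.
  apply/allpairsP/idP => [[[i t] [_ tn /= [_ ->]]]|sn]; first by rewrite -mem_words.
  by exists (j, s); rewrite mem_enum mem_words.
have ur : uniq r.
  apply: allpairs_uniq; [exact: enum_uniq | exact: uniq_words |].
  by move=> [c s] [d t] _ _ /= [-> ->].
rewrite /cont_ext (fsbigE r') //; last first.
- move=> p _ pr; apply/eqP; rewrite mulf_eq0; apply/orP; right.
  apply: contraNT pr => /fn; rewrite -(mem_r (phd p)) mem_pmap_sub.
  by rewrite /phd /parr -surjective_pairing.
- by rewrite pmap_sub_uniq.
rewrite (eq_bigl xpredT) => [|p]; last exact: in_setT.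
rewrite big_pmap big_allpairs big_enum /=; apply: eq_bigr => j _; apply: eq_bigr => s _.
by rewrite /coef; case: insubP => [p _ E|_] /=; rewrite ?mul0r // /phd /parr E.
Qed.

End ContinuousExtension.

(** * Sums of coefficients over the rotations of a word *)

Section CyclicSums.
Variables (K : fieldType) (Q : quiver).
Local Notation A := (cpa K Q).
Implicit Types (u v x y : A) (i j : vert Q) (s t : seq (arr Q)) (a b c d : arr Q).

Definition ccoef u s : K := \sum_j coef u j s.

(** For a periodic [t] equal rotations are counted repeatedly, exactly as the sum over positions in
    a cyclic derivative does. These numbers are all that cyclic derivatives see of [u]. *)
Definition cyc u t : K := \sum_(n < size t) ccoef u (rot n t).

Lemma ccoef_cons u c s : ccoef u (c :: s) = coef u (hd c) (c :: s).
Proof.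
rewrite /ccoef (bigD1 (hd c)) //= big1 ?addr0 // => j jc.
by rewrite coef_nwf //= eq_sym (negPf jc).
Qed.

Lemma ccoef_path_elt i s t :
  ccoef (path_elt K i s) t = (wfp i s && (t == s))%:R.
Proof.
rewrite /ccoef (bigD1 i) //= coef_path_elt eqxx andbT.
rewrite big1 ?addr0 => [|j /negPf ji]; last by rewrite coef_path_elt ji andbF.
by case: eqP => [->|_]; rewrite ?andbF.
Qed.

Lemma sum_shift (f : nat -> K) n : f n = f 0%N ->
  \sum_(m < n) f m.+1 = \sum_(m < n) f m.
Proof.
case: n => [|n] fn; first by rewrite !big_ord0.
by rewrite big_ord_recr [RHS]big_ord_recl /= fn addrC.
Qed.

Lemma cyc_rot1 u t : cyc u (rot 1 t) = cyc u t.
Proof.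
rewrite /cyc size_rot -(@sum_shift (fun n => ccoef u (rot n t))).
  by apply: eq_bigr => n _; rewrite [in RHS]rotS // rot_rot.
by rewrite rot_size rot0.
Qed.

Lemma cyc_rcons u c t : cyc u (rcons t c) = cyc u (c :: t).
Proof. by rewrite -[in RHS]cyc_rot1 /rot /= take0 drop0 cats1. Qed.

Lemma cycP (e : K) u v t : cyc (e *: u + v) t = e * cyc u t + cyc v t.
Proof.
rewrite /cyc mulr_sumr -big_split; apply: eq_bigr => n _.
rewrite /ccoef mulr_sumr -big_split; apply: eq_bigr => j _.
by rewrite pa_coefD pa_coefZ.
Qed.

Lemma cycD u v t : cyc (u + v) t = cyc u t + cyc v t.
Proof. by rewrite -[u in LHS]scale1r cycP mul1r. Qed.

Lemma cyc0 t : cyc 0 t = 0.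
Proof. by rewrite /cyc big1 // => n _; rewrite /ccoef big1 // => j _; rewrite pa_coef0. Qed.

Lemma cycB u v t : cyc (u - v) t = cyc u t - cyc v t.
Proof. by rewrite addrC -scaleN1r cycP mulN1r addrC. Qed.

Definition wderiv w c s : A :=
  \sum_(n < size s | take (size w) (rot n s) == w)
    path_elt K (tl c) (drop (size w) (rot n s)).

(** Rotating [s] by n gives [w ++ parr q] exactly when [s] is the inverse rotation of that word. A
    sum over positions in a varying [s] thus becomes a sum over rotations of one word fixed by [q],
    and the sum over [s] can be carried out afterwards. *)
Lemma wderivE w c s q : wderiv w c s q = (phd q == tl c)%:R *
  \sum_(n < size (w ++ parr q)) (s == rotr n (w ++ parr q))%:R.
Proof.
have -> : wderiv w c s q = \sum_(n < size s)
    ((phd q == tl c) && (rot n s == w ++ parr q))%:R.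
  rewrite /wderiv big_mkcond /=.
  rewrite (big_morph (fun u : A => u q) (id1 := 0) (op1 := +%R)) //.
  apply: eq_bigr => n _.
  rewrite -[in RHS](cat_take_drop (size w) (rot n s)).
  case: ifPn => [/eqP E|ne].
    rewrite E eqseq_cat // eqxx /path_elt /phd /parr.
    by case: (val q) => i t /=; rewrite xpair_eqE [t == _]eq_sym.
  case: eqP => //= _; case: eqP => // E.
  by case/negP: ne; rewrite cat_take_drop in E; rewrite E take_size_cat.
rewrite mulr_sumr; set t := w ++ parr q.
have [E|ne] := eqVneq (size s) (size t).
  rewrite E; apply: eq_bigr => n _; rewrite -natrM mulnb.
  by rewrite -(inj_eq (@rotr_inj n _)) rotK.
rewrite !big1 // => n _.
  case: (s =P _) => E; rewrite ?mulr0 //.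
  by rewrite E size_rotr eqxx in ne.
case: (_ =P t) => E; rewrite ?andbF //.
by rewrite -E size_rot eqxx in ne.
Qed.

Lemma cyc_rotr u t : \sum_(n < size t) ccoef u (rotr n t) = cyc u t.
Proof.
rewrite (reindex_inj rev_ord_inj) /= /cyc.
(* After the reversal of the index the rotations run from 1 to [size t] instead of from 0; the full
   rotation is the identity. *)
rewrite -(@sum_shift (fun n => ccoef u (rot n t))) ?rot_size ?rot0 //.
by apply: eq_bigr => n _; rewrite /rotr subKn.
Qed.

Lemma word_deriv_cyc w c u q :
  cont_ext (word_deriv K w c) u q = (phd q == tl c)%:R * cyc u (w ++ parr q).
Proof.
rewrite -cyc_rotr.
rewrite (@cont_extE _ _ _ (fun _ s => wderiv w c s) u q (size (w ++ parr q))); last first.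
  move=> _ s; rewrite wderivE; apply: contraNT; rewrite -ltnNge => lt.
  rewrite big1 ?mulr0 // => n _; case: eqP => // E.
  by rewrite E size_rotr ltnn in lt.
rewrite mulr_sumr exchange_big /=.
transitivity (\sum_(s <- words Q (size (w ++ parr q)))
   \sum_(n < size (w ++ parr q)) (phd q == tl c)%:R *
     (ccoef u s * (s == rotr n (w ++ parr q))%:R)).
  apply: eq_bigr => s _; rewrite -mulr_suml -/(ccoef u s) wderivE.
  rewrite mulrCA mulr_sumr; by rewrite mulr_sumr.
rewrite exchange_big /=; apply: eq_bigr => n _; rewrite -mulr_sumr; congr (_ * _).
rewrite (bigD1_seq (rotr n (w ++ parr q))) ?uniq_words ?mem_words ?size_rotr //=.
rewrite eqxx mulr1 big1 ?addr0 // => s /negPf ->; by rewrite mulr0.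
Qed.

Lemma cyc_derivE c u q :
  cyc_deriv c u q = (phd q == tl c)%:R * cyc u (c :: parr q).
Proof. exact: word_deriv_cyc. Qed.

Lemma cyc_deriv2E b a u q :
  cyc_deriv2 b a u q = (phd q == tl a)%:R * cyc u [:: b, a & parr q].
Proof. exact: word_deriv_cyc. Qed.

Lemma coef_cyc_deriv c u i s : coef (cyc_deriv c u) i s =
  if wfp i s then (i == tl c)%:R * cyc u (c :: s) else 0.
Proof.
pose f (i : vert Q) s := (i == tl c)%:R * cyc u (c :: s).
have -> : cyc_deriv c u = (fun q => f (phd q) (parr q)).
  by apply/funext => q; rewrite cyc_derivE.
by rewrite coef_fun.
Qed.

Lemma coef_cyc_deriv2 b a u i s : coef (cyc_deriv2 b a u) i s =
  if wfp i s then (i == tl a)%:R * cyc u [:: b, a & s] else 0.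
Proof.
pose f (i : vert Q) s := (i == tl a)%:R * cyc u [:: b, a & s].
have -> : cyc_deriv2 b a u = (fun q => f (phd q) (parr q)).
  by apply/funext => q; rewrite cyc_deriv2E.
by rewrite coef_fun.
Qed.

(** The linear form [cyc _ t] vanishes on the difference of a cycle and its rotation and reads only
    words of the length of [t], so it vanishes on the closure of the span of these differences. *)
Lemma cyc_equivE u v t : cyc_equiv u v -> cyc u t = cyc v t.
Proof.
move=> /(_ (size t).+1)[x Lx /ideal_pow_filt fx].
have x0 : forall t, cyc x t = 0.
  have UP e y z : (forall t, cyc y t = 0) -> (forall t, cyc z t = 0) ->
      forall t, cyc (e *: y + z) t = 0.
    by move=> y0 z0 t'; rewrite cycP y0 z0 mulr0 addr0.
  apply: (Lx (@Subspace K A (fun y => forall t, cyc y t = 0) cyc0 UP)).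
  move=> _ [p cp [c [s [ps ->]]]] t' /=; rewrite cycB.
  have wf : wfp (phd p) (c :: s) by rewrite -ps; apply: pdata_wf.
  have /andP[hc ws] : (hd c == phd p) && wfp (tl c) s by [].
  have pE : ptl (tl c) s = hd c.
    by rewrite (eqP hc); move: cp; rewrite /cyclic_path ps => /eqP.
  rewrite -[X in _ - X]cyc_rot1 /cyc size_rot -sumrB big1 // => n _.
  rewrite rot_rot !ccoef_path_elt wfp_rcons wf ws pE eqxx.
  have -> : rcons s c = rot 1 (c :: s) by rewrite /rot /= take0 drop0 cats1.
  by rewrite (inj_eq (@rot_inj 1 _)) subrr.
apply/eqP; rewrite -subr_eq0 -cycB; apply/eqP.
rewrite -[u - v](subrK x) cycD x0 addr0 /cyc big1 // => n _.
by rewrite /ccoef big1 // => j _; rewrite fx // size_rot.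
Qed.

Definition follows c d := hd d == tl c.

Lemma wfp_path i c s : wfp i (c :: s) = (hd c == i) && path follows c s.
Proof. by elim: s i c => [|d s IH] i c //=; rewrite -IH. Qed.

Lemma ptl_last i c s : ptl i (c :: s) = tl (last c s).
Proof. by rewrite /ptl /= last_map. Qed.

Lemma potential_cycle u t : is_potential u -> cyc u t != 0 -> cycle follows t.
Proof.
move=> pu; apply: contraNT => nc; rewrite /cyc big1 // => n _.
rewrite -(rot_cycle n) in nc; case: (rot n t) nc => //= c s nc.
rewrite ccoef_cons; apply: contraNeq nc; rewrite /coef.
case: insubP => [p _ E|]; last by rewrite eqxx.
move=> /pu /andP[]; have := valP p; rewrite /cyclic_path /phd /parr E wfp_path eqxx /=.
by rewrite ptl_last rcons_path /follows [hd c == _]eq_sym => -> ->.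
Qed.

Section Derivatives.
Variables (u : A) (pu : is_potential u) (lf : loop_free Q).

Lemma cyc_deriv2_hd b a : idem K (tl a) * cyc_deriv2 b a u = cyc_deriv2 b a u.
Proof.
apply: coef_inj => i s; rewrite coef_idemM coef_cyc_deriv2.
by case: ifP; rewrite ?mulr0 // mulrA -natrM mulnb andbb.
Qed.

Lemma cyc_deriv_ptl c i s : coef (cyc_deriv c u) i s != 0 -> ptl i s = hd c.
Proof.
rewrite coef_cyc_deriv; case: ifP => _; rewrite ?eqxx // mulf_eq0 negb_or.
have [->|] := eqVneq i (tl c); last by rewrite eqxx.
move=> /andP[_ /(potential_cycle pu)] /=; rewrite rcons_path => /andP[_ /eqP ->].
by rewrite /ptl last_map.
Qed.

Lemma cyc_deriv2_ptl b a i s : coef (cyc_deriv2 b a u) i s != 0 -> ptl i s = hd b.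
Proof.
rewrite coef_cyc_deriv2; case: ifP => _; rewrite ?eqxx // mulf_eq0 negb_or.
have [->|] := eqVneq i (tl a); last by rewrite eqxx.
move=> /andP[_ /(potential_cycle pu)] /=; rewrite rcons_path => /and3P[_ _ /eqP ->].
by rewrite /ptl last_map.
Qed.

Lemma cyc_deriv2_tl b a : cyc_deriv2 b a u * idem K (hd b) = cyc_deriv2 b a u.
Proof.
apply: coef_inj => i s; rewrite coefM_idem.
have [->|/cyc_deriv2_ptl ->] := eqVneq (coef (cyc_deriv2 b a u) i s) 0.
  by rewrite mulr0.
by rewrite eqxx mul1r.
Qed.

Lemma cyc_loop0 c : cyc u [:: c] = 0.
Proof.
apply/eqP; apply/negPn/negP => /(potential_cycle pu).
by rewrite /= andbT => /eqP /lf.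
Qed.

(** The derivative along [b] is split by its first arrow, which ends at [k]; without loops it has no
    constant term. In the Jacobian algebra this reads alpha gamma = 0. *)
Lemma sum_arrow_cyc_deriv2 (k : vert Q) b : tl b = k ->
  \sum_(a : arrow_in k) arrow_elt K (val a) * cyc_deriv2 b (val a) u = cyc_deriv b u.
Proof.
move=> bk; apply: coef_inj => i s; rewrite pa_coef_sum coef_cyc_deriv.
case: s => [|a s].
  rewrite big1 => [|a _]; last exact: coef_arrowM0.
  by rewrite /= cyc_loop0 mulr0.
rewrite /= bk; have [ak|ak] := boolP (hd a == k); last first.
  rewrite big1 => [|a' _]; last first.
    rewrite coef_arrowM [a == _]negbTE ?andbF ?mul0r //.
    by apply: contraNneq ak => ->; apply: valP a'.
  case: ifP => // /andP[/eqP <- _]; by rewrite (negPf ak) mul0r.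
rewrite (bigD1 (exist _ a ak)) //= big1 ?addr0 => [|a' ne]; last first.
  rewrite coef_arrowM; case: (a =P _) => [E|_]; last by rewrite andbF mul0r.
  by case/eqP: ne; apply: val_inj.
rewrite coef_arrowM eqxx andbT coef_cyc_deriv2 eqxx mul1r -(eqP ak) [hd a == i]eq_sym.
by case: (i == hd a); rewrite /= ?mul0r // !mul1r.
Qed.

(** Dual splitting by the last arrow [b], which a rotation moves in front of [a]. It gives gamma
    beta = 0. *)
Lemma sum_cyc_deriv2_arrow (k : vert Q) a : hd a = k ->
  \sum_(b : arrow_out k) cyc_deriv2 (val b) a u * arrow_elt K (val b) = cyc_deriv a u.
Proof.
move=> ak; apply: coef_inj => i s; rewrite pa_coef_sum coef_cyc_deriv.
case/lastP: s => [|s b].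
  rewrite big1 => [|b _]; last exact: coefM_arrow0.
  by rewrite /= cyc_loop0 mulr0.
rewrite wfp_rcons; have [bk|bk] := boolP (tl b == k); last first.
  rewrite big1 => [|b' _]; last first.
    rewrite coefM_arrow [b == _]negbTE ?andbF ?mul0r //.
    by apply: contraNneq bk => ->; apply: valP b'.
  have -> : cyc u (a :: rcons s b) = 0.
    apply/eqP; apply: contraNT bk => /(potential_cycle pu).
    by rewrite /= rcons_path last_rcons -ak /follows eq_sym => /andP[].
  by rewrite mulr0; case: ifP.
rewrite (bigD1 (exist _ b bk)) //= big1 ?addr0 => [|b' ne]; last first.
  rewrite coefM_arrow; case: (b =P _) => [E|_]; last by rewrite andbF mul0r.
  by case/eqP: ne; apply: val_inj.
rewrite coefM_arrow eqxx andbT coef_cyc_deriv2 -rcons_cons cyc_rcons [hd b == _]eq_sym.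
by case: eqP => _; case: wfp; rewrite /= ?mul0r ?mul1r.
Qed.

End Derivatives.

End CyclicSums.

(** * The map psi kappa *)

Section Bracket.
Variables (K : fieldType) (Q : quiver) (k : vert Q).
Implicit Types (u v : cpa K Q) (s : seq (mut_arr k)).

Lemma unbracket_cat s t : unbracket (s ++ t) = unbracket s ++ unbracket t.
Proof. by rewrite /unbracket map_cat flatten_cat. Qed.

Lemma wfp_unbracket (i : vert Q) s : ~~ has (@is_star Q k) s ->
  wfp i (unbracket s) = @wfp (mut k) i s.
Proof.
elim: s i => [|x s IH] i //=; rewrite negb_or => /andP[nx /IH {}IH].
rewrite -cat1s unbracket_cat.
case: x nx => [c|b a|c] //= _; rewrite ?IH //.
by rewrite (eqP (valP a)) (eqP (valP b)) eqxx.
Qed.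

Lemma coef_bracket u i s : @coef K (mut k) (bracket u) i s =
  if has (@is_star Q k) s then 0 else coef u i (unbracket s).
Proof.
pose f (i : vert (mut k)) (s : seq (arr (mut k))) :=
  if has (@is_star Q k) s then 0 else coef u i (unbracket s).
rewrite -[bracket u]/(fun q : qpath (mut k) => f (phd q) (parr q)) coef_fun /f.
case: ifPn => // nwf; case: ifPn => // ns.
by rewrite coef_nwf // wfp_unbracket.
Qed.

Lemma bracket_linear : linear (@bracket Q k K).
Proof.
move=> e u v; apply: coef_inj => i s; rewrite pa_coefD pa_coefZ !coef_bracket.
by case: ifP => _; rewrite ?mulr0 ?addr0 // pa_coefD pa_coefZ.
Qed.

HB.instance Definition _ :=
  GRing.isLinear.Build K (cpa K Q) (cpa K (mut k)) *:%R (@bracket Q k K)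
    bracket_linear.

Lemma wfp_del (i : vert (del k)) (s : seq (arr (del k))) :
  wfp i s = wfp (val i) (map val s).
Proof. by elim: s i => //= c s IH i; rewrite IH. Qed.

End Bracket.

Section PsiKappa.
Variables (K : fieldType) (Q : quiver) (k : vert Q) (S : cpa K Q).
Hypotheses (lf : loop_free Q) (n2 : no_2cycle_at k) (pS : is_potential S).
Local Notation Qm := (mut k).
Local Notation H := (hat_mut2 k).
Implicit Types (u v x y : cpa K Qm) (z : arr H).

(** The inverse of [kappa] on words: each letter made of two starred arrows is expanded. *)
Definition hat_word (s : seq (arr H)) : seq (arr Qm) :=
  @unbracket Qm k (map val s).

Lemma hat_not_star z : is_star (val z) = false.
Proof.
case: z => [[y|y y'|c] p] //=; move: (p) => /=.
by rewrite andbC -negb_or (valP c).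
Qed.

Lemma hat_word_cons z s : hat_word (z :: s) = hat_word [:: z] ++ hat_word s.
Proof. by rewrite -[z :: s]cat1s /hat_word map_cat unbracket_cat. Qed.

Lemma wfp_hat_word (i : vert H) s : @wfp Qm (val i) (hat_word s) = wfp i s.
Proof.
rewrite wfp_del wfp_unbracket // has_map; apply/hasPn => z _ /=.
by rewrite hat_not_star.
Qed.

Lemma coef_kappa u (i : vert H) s : coef (kappa u) i s = coef u (val i) (hat_word s).
Proof.
have ns : has (@is_star Qm k) (map val s) = false.
  by apply/negbTE; rewrite has_map; apply/hasPn => z _ /=; rewrite hat_not_star.
pose f (i : vert H) (s : seq (arr H)) := coef (@bracket Qm k K u) (val i) (map val s).
rewrite -[kappa u]/(fun q => f (phd q) (parr q)) coef_fun /f coef_bracket ns.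
by case: ifPn => // nwf; rewrite coef_nwf // wfp_hat_word.
Qed.

Definition ldw (w : seq (arr Qm)) u := foldl (fun v c => ld c v) u w.

Lemma coef_ldw z u i s : coef (ldw (hat_word [:: z]) u) i s =
  if i == val (tl z) then coef u (val (hd z)) (hat_word [:: z] ++ s) else 0.
Proof.
case: z => [[y|y y'|c] p] /=; rewrite /hat_word /unbracket /=.
- by rewrite coef_ld.
- by rewrite !coef_ld (eqP (valP y)) (eqP (valP y')) eqxx.
- by have := hat_not_star (exist _ (Star c) p).
Qed.

Lemma psi_arrow_hd z : @idem K Q (val (hd z)) * psi_arrow S z = psi_arrow S z.
Proof.
case: z => [[[[c|b a|c] q]|[y qy] [y' qy']|c] p]; rewrite /psi_arrow /= ?mulr0 //.
- by rewrite idem_arrow eqxx scale1r.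
- by rewrite mulrA idem_arrow eqxx scale1r.
- case: y qy p => [?|? ?|a] qy p; rewrite ?mulr0 //.
  case: y' qy' p => [?|? ?|b] qy' p; rewrite ?mulr0 //.
  by rewrite mulrN cyc_deriv2_hd.
Qed.

Lemma psi_arrow_tl z : psi_arrow S z * @idem K Q (val (tl z)) = psi_arrow S z.
Proof.
case: z => [[[[c|b a|c] q]|[y qy] [y' qy']|c] p]; rewrite /psi_arrow /= ?mul0r //.
- by rewrite arrow_idem eqxx scale1r.
- by rewrite -mulrA arrow_idem eqxx scale1r.
- case: y qy p => [?|? ?|a] qy p; rewrite ?mul0r //.
  case: y' qy' p => [?|? ?|b] qy' p; rewrite ?mul0r //.
  by rewrite mulNr cyc_deriv2_tl.
Qed.

(** A constant term would come from a 2-cycle [b a] through [k]. *)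
Lemma filt_cyc_deriv2 b a : tl b = k -> hd a = k -> filt 1 (cyc_deriv2 b a S).
Proof.
move=> bk ak i [|//] _; rewrite coef_cyc_deriv2 /=.
have [->|] := eqVneq (cyc S [:: b; a]) 0; first by rewrite mulr0.
move=> /(potential_cycle pS) /and3P[_ /eqP ba _].
by case: (n2 ak bk).
Qed.

Lemma filt_psi_arrow z : filt 1 (psi_arrow S z).
Proof.
case: z => [[[[c|b a|c] q]|[y qy] [y' qy']|c] p]; rewrite /psi_arrow /=;
  do ?[exact: filt_arrow | exact: filt0].
- exact/filtMl/filt_arrow.
- case: y qy p => [?|? ?|a] qy p; do ?exact: filt0.
  case: y' qy' p => [?|? ?|b] qy' p; do ?exact: filt0.
  by apply/filtN/filt_cyc_deriv2; apply/eqP.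
Qed.

Definition psi_word (i : vert H) (s : seq (arr H)) : cpa K Q :=
  @idem K Q (val i) * \prod_(z <- s) psi_arrow S z.

Lemma filt_psi_word i s : filt (size s) (psi_word i s).
Proof.
apply: filtMl; elim: s => [|z s IH] //=; rewrite big_cons.
by apply: (@filtM _ _ 1); [apply: filt_psi_arrow|].
Qed.

Definition psik u := psi S (kappa u).

(** Every letter contributes at least one degree, so words of more than n letters disappear. *)
Lemma psik_trunc n u : filt n.+1 (psik u -
  \sum_i \sum_(s <- words H n) coef u (val i) (hat_word s) *: psi_word i s).
Proof.
move=> i s ns; rewrite pa_coefB pa_coef_sum; apply/eqP; rewrite subr_eq0; apply/eqP.
transitivity (\sum_j \sum_(t <- words H n)
    coef u (val j) (hat_word t) * coef (psi_word j t) i s); last first.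
  apply: eq_bigr => j _; rewrite pa_coef_sum; apply: eq_bigr => t _.
  by rewrite pa_coefZ.
rewrite {1}/coef; case: insubP => [q _ E|nwf]; last first.
  rewrite big1 // => j _; rewrite big1 // => t _.
  by rewrite [coef (psi_word _ _) _ _]coef_nwf ?mulr0.
have -> : i = phd q by rewrite /phd E.
have Es : s = parr q by rewrite /parr E.
rewrite Es /psik /psi -[psi_path S]/(fun p => psi_word (phd p) (parr p)).
rewrite (@cont_extE _ _ _ psi_word _ _ n) => [|j t].
  apply: eq_bigr => j _; apply: eq_bigr => t _.
  by rewrite coef_kappa coef_qpath.
rewrite -coef_qpath -Es; apply: contraNT; rewrite -ltnNge => nt.
by rewrite filt_psi_word // (leq_trans ns).
Qed.

(** The supports of the sums defining [psi] vary with the argument, so linearity is checked on the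
    truncations, which are visibly linear, modulo every [filt n]. *)
Lemma psik_linear : linear psik.
Proof.
pose G n u : cpa K Q :=
  \sum_i \sum_(s <- words H n) coef u (val i) (hat_word s) *: psi_word i s.
move=> e u v; apply/eqP; rewrite -subr_eq0; apply/eqP/filt_eq0 => n.
apply: (@filtS _ _ _ n.+1) => //.
have GP : G n (e *: u + v) = e *: G n u + G n v.
  rewrite /G scaler_sumr -big_split; apply: eq_bigr => i _.
  rewrite /= scaler_sumr -big_split; apply: eq_bigr => s _ /=.
  by rewrite pa_coefD pa_coefZ scalerDl scalerA.
rewrite -[psik (e *: u + v)](subrK (G n (e *: u + v))).
rewrite -[psik u](subrK (G n u)) -[psik v](subrK (G n v)) GP.
set a := psik (e *: u + v) - _; set b := psik u - _; set c := psik v - _.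
have -> : a + (e *: G n u + G n v) - (e *: (b + G n u) + (c + G n v)) =
          a - (e *: b + c).
  by rewrite scalerDr [_ *: b + _ + _]addrACA opprD addrACA subrr addr0.
apply: filtB; last apply: filtD; last exact: psik_trunc.
  by rewrite /a -GP; apply: psik_trunc.
by apply: filtZ; apply: psik_trunc.
Qed.

Definition psik0 u : cpa K Q :=
  \sum_(i : vert H) coef u (val i) [::] *: @idem K Q (val i).

Lemma coef_hat_nwf u (i : vert H) z s :
  i != hd z -> coef u (val i) (hat_word (z :: s)) = 0.
Proof.
by move=> ne; rewrite coef_nwf // wfp_hat_word /= eq_sym (negPf ne).
Qed.

(* Every [psi_arrow S z] has positive degree, so that this recursion determines
   [psik]; identities between values of [psik] are proved modulo [filt n] by
   induction on [n]. *)
Lemma psik_rec u :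
  psik u = psik0 u + \sum_z psi_arrow S z * psik (ldw (hat_word [:: z]) u).
Proof.
pose G n u : cpa K Q :=
  \sum_i \sum_(s <- words H n) coef u (val i) (hat_word s) *: psi_word i s.
apply/eqP; rewrite -subr_eq0; apply/eqP/filt_eq0 => n.
apply: (@filtS _ _ _ n.+1) => //.
(* The truncations satisfy the recursion exactly, with the length bound lowered by one on the
   right. *)
have GS : G n.+1 u = psik0 u + \sum_z psi_arrow S z * G n (ldw (hat_word [:: z]) u).
  rewrite /G exchange_big /= big_cons; congr (_ + _).
    by apply: eq_bigr => i _; rewrite /psi_word big_nil mulr1.
  rewrite big_allpairs_dep big_enum /=; apply: eq_bigr => z _.
  rewrite [in RHS]exchange_big mulr_sumr; apply: eq_bigr => s _ /=.
  rewrite (bigD1 (@hd H z)) //= big1 ?addr0 => [|i ne]; last first.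
    by rewrite coef_hat_nwf // scale0r.
  rewrite (bigD1 (@tl H z)) //= big1 ?addr0 => [|i ne]; last first.
    rewrite coef_ldw; case: eqP => [E|_]; last by rewrite scale0r.
    by case/eqP: ne; apply: val_inj.
  rewrite coef_ldw eqxx -hat_word_cons -cpa_scaleAr; congr (_ *: _).
  by rewrite /psi_word big_cons !mulrA psi_arrow_hd psi_arrow_tl.
rewrite -[psik u](subrK (G n.+1 u)) GS.
set a := psik u - _.
have -> : a + (psik0 u + \sum_z psi_arrow S z * G n (ldw (hat_word [:: z]) u)) -
    (psik0 u + \sum_z psi_arrow S z * psik (ldw (hat_word [:: z]) u)) =
    a - \sum_z psi_arrow S z * (psik (ldw (hat_word [:: z]) u) -
                                 G n (ldw (hat_word [:: z]) u)).
  rewrite -addrA; congr (_ + _); rewrite [psik0 u + _]addrC addrKA -sumrB -sumrN.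
  by apply: eq_bigr => z _; rewrite mulrBr opprB.
apply: filtB; first by apply: (@filtS _ _ _ n.+2) => //; rewrite /a -GS; apply: psik_trunc.
apply: filt_sum => z _; apply: (@filtM _ _ 1); first exact: filt_psi_arrow.
by apply: (@filtS _ _ _ n.+1) => //; apply: psik_trunc.
Qed.

End PsiKappa.

(** * Cyclic derivatives of the premutated potential *)

Section ArrowDivision.
Variables (K : fieldType) (Q : quiver).
Implicit Types (c d : arr Q) (j : vert Q).

Lemma ld_arrow c d : ld c (arrow_elt K d) = (c == d)%:R *: idem K (tl c).
Proof.
apply: coef_inj => i s; rewrite coef_ld pa_coefZ coef_arrow coef_idem eqseq_cons.
have [->|_] := eqVneq c d; last by rewrite andbF mul0r if_same.
by case: eqP => //= _; rewrite ?eqxx ?mulr0 // mul1r.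
Qed.

Lemma rd_arrow c d : rd c (arrow_elt K d) = (c == d)%:R *: idem K (hd c).
Proof.
apply: coef_inj => i s; rewrite coef_rd pa_coefZ coef_arrow coef_idem -[[:: d]]/(rcons [::] d).
rewrite eqseq_rcons; have [->|_] := eqVneq c d; last by rewrite !andbF mul0r.
by rewrite andbT mul1r.
Qed.

Lemma ld_idem c j : ld c (idem K j) = 0.
Proof.
by apply: coef_inj => i s; rewrite coef_ld pa_coef0 coef_idem andbF if_same.
Qed.

Lemma arrowM_path c d : hd d = tl c ->
  arrow_elt K c * arrow_elt K d = path_elt K (hd c) [:: c; d].
Proof.
move=> dc; apply: coef_inj => i [|e s].
  by rewrite coef_arrowM0 coef_path_elt andbF.
rewrite coef_arrowM coef_arrow coef_path_elt eqseq_cons -dc eqxx /=.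
rewrite -natrM mulnb; congr (_%:R); congr (nat_of_bool _).
have [->|] := eqVneq i (hd c); last by rewrite !(andbF, andFb).
case: (e =P c) => [->|]; last by rewrite !andbF.
rewrite eqxx /=; case: (s =P [:: d]) => [->|]; last by rewrite andbF.
by rewrite /= dc eqxx.
Qed.

Lemma cont_ext_path (Q' : quiver) (f : qpath Q -> cpa K Q') (p : qpath Q) :
  cont_ext f (path_elt K (phd p) (parr p)) = f p.
Proof.
apply/funext => q; rewrite /cont_ext (fsbigE [:: p]) //.
  rewrite big_mkcond big_seq1 in_setT /path_elt /phd /parr -surjective_pairing.
  by rewrite eqxx mul1r.
move=> p' _; rewrite inE /path_elt /phd /parr -surjective_pairing (inj_eq val_inj).
by move=> /negPf ->; rewrite mul0r.
Qed.

Lemma cyc_deriv_linear c : linear (@cyc_deriv K Q c).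
Proof.
move=> e u v; apply: coef_inj => i s; rewrite pa_coefD pa_coefZ !coef_cyc_deriv.
case: ifP => _; last by rewrite mulr0 addr0.
by rewrite cycP mulrDr mulrCA.
Qed.

HB.instance Definition _ c :=
  GRing.isLinear.Build K (cpa K Q) (cpa K Q) *:%R (@cyc_deriv K Q c) (cyc_deriv_linear c).

End ArrowDivision.

Lemma cyc_deriv_triangle (K : fieldType) (Q : quiver) (i : vert Q) (c1 c2 c3 c : arr Q) :
    hd c1 = i -> tl c3 = i -> hd c2 = tl c1 -> hd c3 = tl c2 ->
  let arrow := @arrow_elt K Q in
  cyc_deriv c (path_elt K i [:: c1; c2; c3]) =
    (if c1 == c then arrow c2 * arrow c3 else 0)
  + (if c2 == c then arrow c3 * arrow c1 else 0)
  + (if c3 == c then arrow c1 * arrow c2 else 0).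
Proof.
move=> h1 t3 h2 h3 /=; have wf : wfp i [:: c1; c2; c3] by rewrite /= h1 h2 h3 !eqxx.
pose p := @QPath Q (i, [:: c1; c2; c3]) wf.
rewrite /cyc_deriv (@cont_ext_path _ _ _ (word_deriv K [:: c] c) p).
rewrite /word_deriv /parr /= big_mkcond /= !big_ord_recl big_ord0 addr0 /= addrA.
rewrite !eqseq_cons !andbT !arrowM_path ?h1 ?t3 //.
by congr (_ + _ + _); case: eqP => [<-|] //; congr path_elt; rewrite ?t3.
Qed.

Section BracketDerivatives.
Variables (K : fieldType) (Q : quiver) (k : vert Q).
Implicit Types (u : cpa K Q) (s t : seq (mut_arr k)).

(** Cutting a bracketed word never separates [b] from [a] in [[ba]]. The additional cuts of the
    unbracketed word lie in front of such an [a], which ends at [k], and [h] vanishes there. *)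
Lemma sum_unbracket (h : seq (arr Q) -> seq (arr Q) -> K) s :
    (forall x c y, hd c = k -> h x (c :: y) = 0) -> ~~ has (@is_star Q k) s ->
  \sum_(n < size s) h (unbracket (take n s)) (unbracket (drop n s)) =
  \sum_(n < size (unbracket s)) h (take n (unbracket s)) (drop n (unbracket s)).
Proof.
elim: s h => [|x s IH] h hk /=; first by rewrite !big_ord0.
rewrite negb_or => /andP[nx ns].
have E t : unbracket (x :: t) = unbracket [:: x] ++ unbracket t.
  by rewrite -cat1s unbracket_cat.
have := IH (fun p q => h (unbracket [:: x] ++ p) q) (fun p c y ck => hk _ c y ck) ns.
rewrite big_ord_recl /= => IH'.
under eq_bigr do rewrite E.
rewrite IH' E; case: x nx {IH' E} => [c|b a|c] //= _.
  by rewrite big_ord_recl.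
rewrite !big_ord_recl /= [h [:: val b] _]hk ?add0r //; exact/eqP/(valP a).
Qed.

Lemma ccoef_bracket u s : @ccoef K (mut k) (bracket u) s =
  if has (@is_star Q k) s then 0 else ccoef u (unbracket s).
Proof.
rewrite /ccoef; under eq_bigr do rewrite coef_bracket.
by case: ifP => // _; rewrite big1.
Qed.

(** Here the choice of a potential without cycles starting at [k] enters: a rotation of
    [unbracket t] that begins in the middle of some [b a] has head [k], hence coefficient zero. *)
Lemma cyc_bracket u t : no_cycle_at k u -> @cyc K (mut k) (bracket u) t =
  if has (@is_star Q k) t then 0 else cyc u (unbracket t).
Proof.
move=> uk; rewrite /cyc; under eq_bigr do rewrite ccoef_bracket has_rot.
case: ifPn => [_|ns]; first by rewrite big1.
under eq_bigr do rewrite /rot unbracket_cat.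
apply: (@sum_unbracket (fun x y => ccoef u (y ++ x))) => // x c y ck.
rewrite /= ccoef_cons ck /coef; case: insubP => // p _ E.
apply/eqP; apply/negPn/negP => /uk; by rewrite /phd E eqxx.
Qed.

Lemma cyc_deriv_bracket_keep u (c : arrow_off k) : no_cycle_at k u ->
  @cyc_deriv K (mut k) (Keep c) (bracket u) = bracket (cyc_deriv (val c) u).
Proof.
move=> uk; apply: coef_inj => i s.
rewrite coef_bracket !coef_cyc_deriv cyc_bracket //=.
case: (boolP (has (@is_star Q k) s)) => [_|ns]; first by rewrite mulr0 if_same.
by rewrite wfp_unbracket.
Qed.

Lemma cyc_deriv_bracket_comp u (b : arrow_out k) (a : arrow_in k) : no_cycle_at k u ->
  @cyc_deriv K (mut k) (Comp b a) (bracket u) = bracket (cyc_deriv2 (val b) (val a) u).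
Proof.
move=> uk; apply: coef_inj => i s.
rewrite coef_bracket coef_cyc_deriv coef_cyc_deriv2 cyc_bracket //=.
case: (boolP (has (@is_star Q k) s)) => [_|ns]; first by rewrite mulr0 if_same.
by rewrite wfp_unbracket.
Qed.

Lemma cyc_deriv_bracket_star u c : no_cycle_at k u ->
  @cyc_deriv K (mut k) (Star c) (bracket u) = 0.
Proof.
move=> uk; apply: coef_inj => i s; rewrite pa_coef0 coef_cyc_deriv cyc_bracket //=.
by rewrite mulr0 if_same.
Qed.

Lemma cyc_deriv_mut_triangle (b : arrow_out k) (a : arrow_in k) (c : arr (mut k)) :
  let arrow := @arrow_elt K (mut k) in
  cyc_deriv c (@path_elt K (mut k) k [:: star_out b; Comp b a; star_in a]) =
    (if star_out b == c then arrow (Comp b a) * arrow (star_in a) else 0)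
  + (if (Comp b a : arr (mut k)) == c then arrow (star_in a) * arrow (star_out b) else 0)
  + (if star_in a == c then arrow (star_out b) * arrow (Comp b a) else 0).
Proof.
by apply: cyc_deriv_triangle => //; [apply: eqP (valP b) | apply: eqP (valP a)].
Qed.

Lemma cyc_deriv_mut_potential u (c : arr (mut k)) :
  cyc_deriv c (mut_potential k u) =
  cyc_deriv c (bracket u) + \sum_(b : arrow_out k) \sum_(a : arrow_in k)
    cyc_deriv c (@path_elt K (mut k) k [:: star_out b; Comp b a; star_in a]).
Proof.
rewrite linearD linear_sum; congr (_ + _); apply: eq_bigr => b _.
by rewrite linear_sum.
Qed.

End BracketDerivatives.

(** * Products and values of psi kappa *)

Lemma sum_sub (V : nmodType) (I : finType) (P : pred I) (sT : subFinType P) (f : I -> V) :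
  \sum_(x : sT) f (val x) = \sum_(i | P i) f i.
Proof.
rewrite [RHS](reindex_omap (val : sT -> I) insub) => [|i Pi]; last by rewrite insubT /= SubK.
by apply: eq_bigl => x; rewrite (valP x) valK eqxx.
Qed.

(** * Arrows of the twice premutated quiver away from [k] *)

Section HatArrows.
Variables (Q : quiver) (k : vert Q).
Hypothesis lf : loop_free Q.
Local Notation Qm := (mut k).
Local Notation H := (hat_mut2 k).

Lemma tl_in_neq (a : arrow_in k) : tl (val a) != k.
Proof. by apply/eqP => E; apply: (lf (a := val a)); rewrite E (eqP (valP a)). Qed.

Lemma hd_out_neq (b : arrow_out k) : hd (val b) != k.
Proof. by apply/eqP => E; apply: (lf (a := val b)); rewrite E (eqP (valP b)). Qed.

Definition mut_off (x : mut_arr k) (xk : (mut_hd x != k) && (mut_tl x != k)) :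
  @arrow_off Qm k := exist _ x xk.

Lemma comp_off (b : arrow_out k) (a : arrow_in k) :
  (mut_hd (Comp b a) != k) && (mut_tl (Comp b a) != k).
Proof. by rewrite /= hd_out_neq tl_in_neq. Qed.

Definition star_of_in (a : arrow_in k) : @arrow_out Qm k :=
  exist (fun x : arr Qm => tl x == k) (star_in a) (valP a).

Definition star_of_out (b : arrow_out k) : @arrow_in Qm k :=
  exist (fun x : arr Qm => hd x == k) (star_out b) (valP b).

Lemma star_off (a : arrow_in k) (b : arrow_out k) :
  (mut_hd (Comp (star_of_in a) (star_of_out b)) != k) &&
  (mut_tl (Comp (star_of_in a) (star_of_out b)) != k).
Proof. by rewrite /= tl_in_neq hd_out_neq. Qed.

Definition hat_keep (c : arrow_off k) : arr H :=
  exist _ (Keep (@mut_off (Keep c) (valP c))) (valP c).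

Definition hat_comp (b : arrow_out k) (a : arrow_in k) : arr H :=
  exist _ (Keep (mut_off (comp_off b a))) (comp_off b a).

Definition hat_star (a : arrow_in k) (b : arrow_out k) : arr H :=
  exist _ (Comp (star_of_in a) (star_of_out b)) (star_off a b).

Local Notation T := (arrow_off k + arrow_out k * arrow_in k + arrow_in k * arrow_out k)%type.

Definition hat_dec (z : arr H) : option T :=
  match val z : mut_arr (k : vert Qm) with
  | Keep y =>
      match val y : mut_arr k with
      | Keep c => Some (inl (inl c))
      | Comp b a => Some (inl (inr (b, a)))
      | Star _ => None
      end
  | Comp y x =>
      match val y : mut_arr k, val x : mut_arr k with
      | Star a, Star b =>
          if insub (val a) is Some a' then
            if insub (val b) is Some b' then Some (inr (a', b')) else None
          else None
      | _, _ => None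
      end
  | Star _ => None
  end.

Definition hat_enc (s : T) : arr H :=
  match s with
  | inl (inl c) => hat_keep c
  | inl (inr (b, a)) => hat_comp b a
  | inr (a, b) => hat_star a b
  end.

Lemma hat_encK : pcancel hat_enc hat_dec.
Proof. by case=> [[c|[b a]]|[a b]] //=; rewrite /hat_dec /= !valK. Qed.

(** The three kinds are exhaustive: a starred arrow of the premutation meets [k] and cannot be kept,
    and since [Q] is loop-free, an arrow of the premutation that meets [k] is starred. *)
Lemma hat_decK z : omap hat_enc (hat_dec z) = Some z.
Proof.
case: z => [[[[c|b a|c] q]|[y qy] [x qx]|c] p]; rewrite /hat_dec /=.
- by congr Some; apply: val_inj; congr Keep; apply: val_inj.
- by congr Some; apply: val_inj; congr Keep; apply: val_inj.
- by exfalso; move: (q); rewrite andbC -negb_or (valP c).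
- case: y qy p => [c|b a|[a qa]] qy p /=.
  + by exfalso; case/andP: (valP c) => _ /negP; apply; apply: qy.
  + by exfalso; have /negP := tl_in_neq a; apply; apply: qy.
  case: x qx p => [c|b' a'|[b qb]] qx p /=.
  + by exfalso; case/andP: (valP c) => /negP + _; apply; apply: qx.
  + by exfalso; have /negP := hd_out_neq b'; apply; apply: qx.
  rewrite !insubT /=; congr Some; apply: val_inj; congr Comp; apply: val_inj;
    by congr Star; apply: val_inj.
- by exfalso; move: (p); rewrite andbC -negb_or (valP c).
Qed.

Lemma sum_hat (V : nmodType) (f : arr H -> V) :
  \sum_z f z = \sum_c f (hat_keep c) + \sum_b \sum_a f (hat_comp b a)
    + \sum_a \sum_b f (hat_star a b).
Proof.
rewrite (reindex_omap hat_enc hat_dec) => [|z _]; last exact: hat_decK.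
rewrite (eq_bigl xpredT) => [|s]; last by rewrite hat_encK eqxx.
by rewrite !big_sumType /= !pair_bigA /=; congr (_ + _ + _); apply: eq_bigr => -[].
Qed.

End HatArrows.

Section PsiKappaProduct.
Variables (K : fieldType) (Q : quiver) (k : vert Q) (S : cpa K Q).
Hypotheses (lf : loop_free Q) (n2 : no_2cycle_at k) (pS : is_potential S).
Local Notation Qm := (mut k).
Local Notation H := (hat_mut2 k).
Local Notation F := (psik S).
Implicit Types (u v x y : cpa K Qm) (z : arr H).

HB.instance Definition _ :=
  GRing.isLinear.Build K (cpa K Qm) (cpa K Q) *:%R (psik S) (psik_linear n2 pS).

Lemma psik_recE u : F u = @psik0 K Q k u
  + (\sum_(c : arrow_off k) arrow_elt K (val c) * F (@ld K Qm (Keep c) u)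
  + \sum_(b : arrow_out k) \sum_(a : arrow_in k)
      arrow_elt K (val b) * arrow_elt K (val a) * F (@ld K Qm (Comp b a) u)
  - \sum_(a : arrow_in k) \sum_(b : arrow_out k)
      cyc_deriv2 (val b) (val a) S * F (ld (star_out b) (ld (star_in a) u))).
Proof.
rewrite [LHS](psik_rec n2 pS) (sum_hat lf); congr (_ + (_ + _)).
rewrite -sumrN; apply: eq_bigr => a _; rewrite -sumrN; apply: eq_bigr => b _.
by rewrite mulNr.
Qed.

Lemma hat_val_eq (i j : vert H) : (val i == val j :> vert Q) = (i == j).
Proof. by apply/eqP/eqP => [E|->] //; apply: val_inj. Qed.

(** Besides the two Leibniz terms, a letter [[a^* b^*]] can be cut in the middle: [x] contributes
    the single arrow [a^*] and [y] starts with [b^*]. This third term is the origin of the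
    correction in [psikM]. *)
Lemma ldwM z x y : ldw (hat_word [:: z]) (x * y) = ldw (hat_word [:: z]) x * y
  + coef x (val (hd z)) [::] *: ldw (hat_word [:: z]) y
  + if hat_word [:: z] is [:: c; d] then coef x (hd c) [:: c] *: ld d y else 0.
Proof.
case: z => [[y'|y' y''|c] p] /=; rewrite /hat_word /unbracket /=.
- by rewrite ldM addr0.
- rewrite ldM linearD linearZ /= ldM coef_ld (eqP (valP y')) (eqP (valP y'')) eqxx.
  by rewrite addrAC.
- by have := hat_not_star (exist _ (Star c) p).
Qed.

Lemma psik0M x y : @psik0 K Q k (x * y) = psik0 x * psik0 y.
Proof.
rewrite /psik0 mulr_sumr; apply: eq_bigr => i _; rewrite mulr_suml.
rewrite (bigD1 i) //= big1 ?addr0 => [|j ji].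
  by rewrite pa_coefM big_ord1 -cpa_scaleAl -cpa_scaleAr idemM eqxx scale1r scalerA.
rewrite -cpa_scaleAl -cpa_scaleAr idemM hat_val_eq (negPf ji) scale0r !scaler0 //.
Qed.

Lemma psik0_psi_arrow x z :
  psik0 x * psi_arrow S z = coef x (val (hd z)) [::] *: psi_arrow S z.
Proof.
rewrite /psik0 mulr_suml (bigD1 (hd z)) //= big1 ?addr0 => [|j ji].
  by rewrite -cpa_scaleAl psi_arrow_hd.
rewrite -cpa_scaleAl -psi_arrow_hd mulrA idemM hat_val_eq (negPf ji) scale0r mul0r.
by rewrite scaler0.
Qed.

Lemma psik0_rd_star x (a : arrow_in k) :
  @psik0 K Q k (rd (star_in a) x) =
  coef x (tl (val a)) [:: star_in a] *: @idem K Q (tl (val a)).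
Proof.
pose i : vert H := exist _ (tl (val a)) (tl_in_neq lf a).
rewrite /psik0 (bigD1 i) //= big1 ?addr0 ?coef_rd // => j ji.
rewrite coef_rd coef_nwf ?scale0r //= andbT; apply: contraNneq ji => E.
by apply/eqP/val_inj; rewrite /= -E.
Qed.

Lemma ldw_rd w (c : arr Qm) x : ldw w (rd c x) = rd c (ldw w x).
Proof. by elim: w x => //= d w IH x; rewrite ld_rd IH. Qed.

(** The defect [D] of the formula satisfies a homogeneous recursion on the first letter of [x]. As
    each letter raises the order, [D] lies in every [filt n]. *)
Lemma psikM x y : F (x * y) = F x * F y - \sum_(a : arrow_in k) \sum_(b : arrow_out k)
  F (rd (star_in a) x) * cyc_deriv2 (val b) (val a) S * F (ld (star_out b) y).
Proof.
pose W x y := \sum_(a : arrow_in k) \sum_(b : arrow_out k)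
  F (rd (star_in a) x) * cyc_deriv2 (val b) (val a) S * F (ld (star_out b) y).
pose D x y := F (x * y) - F x * F y + W x y.
suff D0 n : filt n (D x y).
  apply/eqP; rewrite -subr_eq0 opprB addrA addrAC; apply/eqP.
  by apply: filt_eq0 => n; apply: D0.
elim: n x => [|n IH] x; first exact: filt_any.
have -> : D x y = \sum_z psi_arrow S z * D (ldw (hat_word [:: z]) x) y.
  (* [V] gathers the words in which [x] contributes exactly [a^*]. It enters [E1] with a minus sign
     because [psi] sends [[a^* b^*]] to minus a second derivative. *)
  pose V := \sum_(a : arrow_in k) \sum_(b : arrow_out k)
    coef x (tl (val a)) [:: star_in a] *:
      (cyc_deriv2 (val b) (val a) S * F (ld (star_out b) y)).
  have E1 : F (x * y) = psik0 x * F y +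
      \sum_z psi_arrow S z * F (ldw (hat_word [:: z]) x * y) - V.
    rewrite [LHS](psik_rec n2 pS) psik0M [F y](psik_rec n2 pS) mulrDr -!addrA.
    congr (_ + _); pose ex z :=
      if hat_word [:: z] is [:: c; d] then coef x (hd c) [:: c] *: ld d y else 0.
    have -> : V = - \sum_z psi_arrow S z * F (ex z).
      rewrite (sum_hat lf) [X in X + _ + _]big1 => [|c _]; last first.
        by rewrite linear0 mulr0.
      rewrite [X in _ + X + _]big1 => [|b _]; last first.
        by rewrite big1 // => a _; rewrite linear0 mulr0.
      rewrite add0r add0r -sumrN; apply: eq_bigr => a _.
      rewrite -sumrN; apply: eq_bigr => b _.
      by rewrite /ex /= linearZ mulNr opprK -cpa_scaleAr.
    rewrite opprK mulr_sumr -!big_split; apply: eq_bigr => z _ /=.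
    rewrite ldwM -/(ex z) 2!linearD linearZ 2!mulrDr mulrA psik0_psi_arrow.
    by rewrite -cpa_scaleAl -cpa_scaleAr addrA [X in X + _]addrC.
  have E2 : F x * F y = psik0 x * F y +
      \sum_z psi_arrow S z * (F (ldw (hat_word [:: z]) x) * F y).
    rewrite [F x](psik_rec n2 pS) mulrDl mulr_suml; congr (_ + _).
    by apply: eq_bigr => z _; rewrite mulrA.
  (* [V] arises again from the constant terms of the right quotients of [x], so it cancels in
     [D]. *)
  have E3 : W x y = V + \sum_z psi_arrow S z * W (ldw (hat_word [:: z]) x) y.
    have -> : \sum_z psi_arrow S z * W (ldw (hat_word [:: z]) x) y =
        \sum_(a : arrow_in k) \sum_(b : arrow_out k)
        (\sum_z psi_arrow S z * F (ldw (hat_word [:: z]) (rd (star_in a) x))) *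
          cyc_deriv2 (val b) (val a) S * F (ld (star_out b) y).
      under eq_bigr do rewrite mulr_sumr.
      rewrite exchange_big; apply: eq_bigr => a _ /=.
      under eq_bigr do rewrite mulr_sumr.
      rewrite exchange_big; apply: eq_bigr => b _ /=.
      rewrite !mulr_suml; apply: eq_bigr => z _.
      by rewrite !mulrA ldw_rd.
    rewrite /W /V -big_split; apply: eq_bigr => a _ /=.
    rewrite -big_split; apply: eq_bigr => b _ /=.
    rewrite [F (rd _ _)](psik_rec n2 pS) psik0_rd_star !mulrDl; congr (_ + _).
    by rewrite -!cpa_scaleAl cyc_deriv2_hd.
  rewrite /D E1 E2 E3; set X := \sum_z _; set Y := \sum_z _; set Z := \sum_z _.
  set P := psik0 x * F y.
  have -> : P + X - V - (P + Y) + (V + Z) = X - Y + Z.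
    rewrite [P + X]addrC [X + P - V]addrAC opprD [_ + P + _]addrA addrK.
    by rewrite addrA [X - V - Y]addrAC subrK.
  rewrite /X /Y /Z -sumrB -big_split; apply: eq_bigr => z _ /=.
  by rewrite -mulrBr -mulrDr.
apply: filt_sum => z _; apply: (@filtM _ _ 1) => //; exact: filt_psi_arrow.
Qed.

(** [kappa] reads only paths that neither start nor end at [k]. *)
Lemma psik_ext u v :
    (forall (i : vert Q) s, i != k -> @ptl Qm i s != k -> coef u i s = coef v i s) ->
  F u = F v.
Proof.
move=> uv; rewrite /psik; congr psi; apply: coef_inj => i s; rewrite !coef_kappa.
have [wf|nwf] := boolP (wfp i s); last by rewrite !coef_nwf // wfp_hat_word.
apply: uv; first exact: (valP i).
suff -> : @ptl Qm (val i) (hat_word s) = val (ptl i s) by apply: (valP (ptl i s)).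
elim: s i {wf} => [|z s IH] i //; rewrite hat_word_cons /ptl map_cat last_cat.
have -> : last (val i : vert Qm) [seq @tl Qm i | i <- hat_word [:: z]] = val (tl z).
  case: z => [[y|y y'|c] p] //=.
  by have := hat_not_star (exist _ (Star c) p).
exact: (IH (tl z)).
Qed.

Lemma psik_hd0 u : (forall (i : vert Q) s, i != k -> coef u i s = 0) -> F u = 0.
Proof.
move=> u0; rewrite -[RHS](linear0 F); apply: psik_ext => i s ik _.
by rewrite u0 // pa_coef0.
Qed.

Lemma psik_tl0 u : (forall i s, @ptl Qm i s != k -> coef u i s = 0) -> F u = 0.
Proof.
move=> u0; rewrite -[RHS](linear0 F); apply: psik_ext => i s _ sk.
by rewrite u0 // pa_coef0.
Qed.

Lemma psik_idem j : j != k -> F (@idem K Qm j) = @idem K Q j.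
Proof.
move=> jk; rewrite psik_recE.
rewrite [X in X + _ - _]big1 ?add0r => [|c _]; last by rewrite ld_idem linear0 mulr0.
rewrite [X in _ + (X - _)]big1 ?add0r => [|b _]; last first.
  by rewrite big1 // => a _; rewrite ld_idem linear0 mulr0.
rewrite big1 ?subr0 => [|a _]; last first.
  by rewrite big1 // => b _; rewrite ld_idem !linear0 mulr0.
rewrite /psik0 (bigD1 (exist _ j jk)) //= coef_idem eqxx scale1r big1 ?addr0 //.
move=> i ne; rewrite coef_idem andbT [_ == j]negbTE ?scale0r //.
Qed.

Lemma psik_comp (b : arrow_out k) (a : arrow_in k) :
  F (@arrow_elt K Qm (Comp b a)) = arrow_elt K (val b) * arrow_elt K (val a).
Proof.
rewrite psik_recE.
rewrite [psik0 _]big1 ?add0r => [|i _]; last by rewrite coef_arrow andbF scale0r.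
rewrite [X in X + _ - _]big1 ?add0r => [|c _]; last first.
  by rewrite ld_arrow scale0r linear0 mulr0.
rewrite [X in _ - X]big1 ?subr0 => [|a' _]; last first.
  by rewrite big1 // => b' _; rewrite ld_arrow scale0r !linear0 mulr0.
rewrite (bigD1 b) //= [X in _ + X]big1 ?addr0 => [|b' ne]; last first.
  rewrite big1 // => a' _; rewrite ld_arrow; case: eqP => [[E _]|_].
    by rewrite E eqxx in ne.
  by rewrite scale0r linear0 mulr0.
rewrite (bigD1 a) //= big1 ?addr0 => [|a' ne]; last first.
  rewrite ld_arrow; case: eqP => [[E]|_]; first by rewrite E eqxx in ne.
  by rewrite scale0r linear0 mulr0.
rewrite ld_arrow eqxx scale1r /= psik_idem ?tl_in_neq //.
by rewrite -mulrA arrow_idem eqxx scale1r.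
Qed.

Lemma psik_star_star (a : arrow_in k) (b : arrow_out k) :
  F (@arrow_elt K Qm (star_in a) * @arrow_elt K Qm (star_out b)) =
  - cyc_deriv2 (val b) (val a) S.
Proof.
rewrite psikM [F (@arrow_elt K Qm (star_in a))]psik_tl0 ?mul0r ?sub0r => [|i s]; last first.
  rewrite coef_arrow; case: (s =P _) => [->|_]; last by rewrite andbF.
  by rewrite /ptl /= (eqP (valP a)) eqxx.
congr (- _); rewrite (bigD1 a) //= [X in _ + X]big1 ?addr0 => [|a' ne]; last first.
  rewrite big1 // => b' _; rewrite rd_arrow; case: eqP => [[E]|_].
    by case/eqP: ne; apply: val_inj.
  by rewrite scale0r linear0 !mul0r.
rewrite (bigD1 b) //= big1 ?addr0 => [|b' ne]; last first.
  rewrite ld_arrow; case: eqP => [[E]|_]; first by case/eqP: ne; apply: val_inj.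
  by rewrite scale0r linear0 mulr0.
rewrite rd_arrow ld_arrow !eqxx !scale1r /= !psik_idem ?tl_in_neq ?hd_out_neq //.
by rewrite cyc_deriv2_hd cyc_deriv2_tl.
Qed.

(** A letter may expand to two arrows of the premutation while its image is only known to have order
    at least one, whence the factor two. *)
Lemma filt_psik n u : filt n.*2 u -> filt n (F u).
Proof.
elim: n u => [|n IH] u fu; first exact: filt_any.
rewrite (psik_rec n2 pS); apply: filtD.
  apply: filt_sum => i _; rewrite fu ?scale0r //; exact: filt0.
apply: filt_sum => z _; apply: (@filtM _ _ 1); first exact: filt_psi_arrow.
apply: IH; move: fu; rewrite doubleS.
case: z => [[y|y y'|c] p] fu /=; rewrite /hat_word /unbracket /=.
- by apply: filt_ld; apply: filtS fu.
- exact/filt_ld/filt_ld.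
- by have := hat_not_star (exist _ (Star c) p).
Qed.

Definition hat_supported (u : cpa K Q) :=
  forall i s, coef u i s != 0 -> (i != k) && (ptl i s != k).

Lemma hat_supported_ld (u : cpa K Q) c :
  tl c != k -> hat_supported u -> hat_supported (ld c u).
Proof.
move=> ck hu i s; rewrite coef_ld; case: (i =P _) => [->|_]; last by rewrite eqxx.
by move=> /hu /andP[_]; rewrite ck.
Qed.

(** A path that avoids [k] at both ends starts with an arrow avoiding [k] or with a pair [b a]
    through [k]. These are the unstarred letters, so the terms match those of [psik_recE]. *)
Lemma hat_decomp (u : cpa K Q) : hat_supported u ->
  u = \sum_(i : vert H) coef u (val i) [::] *: @idem K Q (val i)
    + (\sum_(c : arrow_off k) arrow_elt K (val c) * ld (val c) u
      + \sum_(b : arrow_out k) \sum_(a : arrow_in k)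
          arrow_elt K (val b) * arrow_elt K (val a) * ld (val a) (ld (val b) u)).
Proof.
move=> hu; rewrite {1}[u]arrow_decomp; congr (_ + _).
  rewrite (bigID (fun j => j != k)) /= [X in _ + X]big1 ?addr0 => [|j jk].
    by rewrite -(@sum_sub _ _ _ {j : vert Q | j != k} (fun j => coef u j [::] *: idem K j)).
  have [->|/hu] := eqVneq (coef u j [::]) 0; first by rewrite scale0r.
  by rewrite (negPf jk).
have hd0 c : hd c = k -> ld c u = 0.
  move=> ck; apply: coef_inj => i s; rewrite coef_ld pa_coef0.
  case: eqP => // _; apply/eqP/negPn/negP => /hu; by rewrite ck eqxx.
rewrite (bigID (fun c => (hd c != k) && (tl c != k))) /=; congr (_ + _).
  by rewrite -(@sum_sub _ _ _ (arrow_off k) (fun c => arrow_elt K c * ld c u)).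
rewrite (bigID (fun c => tl c == k)) /= [X in _ + X]big1 ?addr0 => [|c]; last first.
  case/andP; rewrite negb_and !negbK => /orP[/eqP /hd0 -> _|->] //.
  by rewrite mulr0.
rewrite (eq_bigl (fun c => tl c == k)) => [|c]; last first.
  by case: (tl c == k); rewrite ?andbF ?andbT.
rewrite -(@sum_sub _ _ _ (arrow_out k) (fun c => arrow_elt K c * ld c u)).
apply: eq_bigr => b _.
have bk := eqP (valP b); rewrite {1}[ld _ u]arrow_decomp big1 ?add0r => [|j _]; last first.
  rewrite coef_ld; case: eqP => [jE|_]; last by rewrite scale0r.
  have [->|/hu /andP[_]] := eqVneq (coef u (hd (val b)) [:: val b]) 0.
    by rewrite scale0r.
  by rewrite /ptl /= bk eqxx.
rewrite mulr_sumr (bigID (fun c => hd c == k)) /= [X in _ + X]big1 ?addr0 => [|c ck].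
  rewrite -(@sum_sub _ _ _ (arrow_in k)
    (fun c => arrow_elt K (val b) * (arrow_elt K c * ld c (ld (val b) u)))).
  by apply: eq_bigr => a _; rewrite mulrA.
suff -> : ld c (ld (val b) u) = 0 by rewrite !mulr0.
apply: coef_inj => i s; rewrite pa_coef0 !coef_ld bk (negPf ck) if_same //.
Qed.

Lemma ld_bracket_keep (c : arrow_off k) (u : cpa K Q) :
  @ld K Qm (Keep c) (bracket u) = bracket (ld (val c) u).
Proof.
apply: coef_inj => i s; rewrite coef_ld !coef_bracket coef_ld /=.
by case: eqP => //=; rewrite if_same.
Qed.

Lemma ld_bracket_comp (b : arrow_out k) (a : arrow_in k) (u : cpa K Q) :
  @ld K Qm (Comp b a) (bracket u) = bracket (ld (val a) (ld (val b) u)).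
Proof.
apply: coef_inj => i s; rewrite coef_ld !coef_bracket !coef_ld /=.
by rewrite (eqP (valP a)) (eqP (valP b)) eqxx; case: eqP => //=; rewrite if_same.
Qed.

Lemma ld_bracket_star c (u : cpa K Q) : @ld K Qm (Star c) (bracket u) = 0.
Proof. by apply: coef_inj => i s; rewrite coef_ld pa_coef0 coef_bracket if_same. Qed.

Lemma rd_bracket_star c (u : cpa K Q) : @rd K Qm (Star c) (bracket u) = 0.
Proof.
by apply: coef_inj => i s; rewrite coef_rd pa_coef0 coef_bracket has_rcons.
Qed.

(** Quotients of [bracket u] by starred arrows vanish, so both sides obey the same recursion. *)
Lemma psik_bracket (u : cpa K Q) : hat_supported u -> F (bracket u : cpa K Qm) = u.
Proof.
move=> hu; apply/eqP; rewrite -subr_eq0; apply/eqP/filt_eq0 => n.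
elim: n u hu => [|n IH] u hu; first exact: filt_any.
rewrite [X in _ - X](hat_decomp hu) psik_recE.
rewrite [X in _ + (_ + _ - X)]big1 ?subr0 => [|a _]; last first.
  by rewrite big1 // => b _; rewrite ld_bracket_star !linear0 mulr0.
have -> : @psik0 K Q k (bracket u) =
    \sum_(i : vert H) coef u (val i) [::] *: @idem K Q (val i).
  by apply: eq_bigr => i _; rewrite coef_bracket.
rewrite opprD addrACA subrr add0r.
rewrite opprD addrACA -!sumrB; apply: filtD.
  apply: filt_sum => c _; rewrite ld_bracket_keep -mulrBr.
  apply: (@filtM _ _ 1); first exact: filt_arrow.
  by apply: IH; apply: hat_supported_ld => //; case/andP: (valP c).
apply: filt_sum => b _; rewrite -sumrB; apply: filt_sum => a _.
rewrite ld_bracket_comp -mulrBr; apply: (@filtM _ _ 1).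
  by apply/filtMr/filt_arrow.
apply: IH => i s; rewrite !coef_ld; case: (i =P _) => [->|_]; last by rewrite eqxx.
rewrite (eqP (valP a)) (eqP (valP b)) eqxx => /hu /andP[_].
by rewrite tl_in_neq.
Qed.

End PsiKappaProduct.

(** * The ideal of negligible elements *)

Lemma quotring_pi_eq0 (R : pzRingType) (I : tsideal R) x :
  quotring_pi I x = 0 <-> I x.
Proof.
have E : (x - 0 \in tsideal_pred I) = (quotring_pi I x == quotring_pi I 0).
  by rewrite Quotient.idealrBE.
rewrite subr0 raddf0 in E; split=> [x0|Ix].
  by apply/asboolP; rewrite -[`[< _ >]]/(x \in tsideal_pred I) E x0.
by apply/eqP; rewrite -E; apply/asboolP.
Qed.

Lemma jacobian_cyc_deriv (K : fieldType) (Q : quiver) (S : cpa K Q) c :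
  jacobian S (cyc_deriv c S).
Proof.
apply: jacobian_closed => n; exists (cyc_deriv c S); last by rewrite subrr; apply: filt0.
suff: adic_closure (max_ideal K Q) (ideal_gen (range (fun a => cyc_deriv a S)))
  (cyc_deriv c S) by [].
move=> m; exists (cyc_deriv c S); last by rewrite subrr; apply: tsideal0.
by move=> I; apply; exists c.
Qed.

Section AnnihilatorIdeal.
Variables (K : fieldType) (Q : quiver) (k : vert Q) (S : cpa K Q).
Hypotheses (lf : loop_free Q) (n2 : no_2cycle_at k) (pS : is_potential S).
Local Notation Qm := (mut k).
Local Notation F := (@psik K Q k S).
Local Notation pi := (quotring_pi (jacobian S)).
Local Notation In := (arrow_in k).
Local Notation Out := (arrow_out k).
Local Notation Gamma a b := (cyc_deriv2 (val b) (val a) S).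
Implicit Types (u v x y : cpa K Qm) (s : option Out) (t : option In).

Let piM (x y : cpa K Q) : pi (x * y) = pi x * pi y := rmorphM _ x y.
Let piD (x y : cpa K Q) : pi (x + y) = pi x + pi y := rmorphD _ x y.
Let piB (x y : cpa K Q) : pi (x - y) = pi x - pi y := rmorphB _ x y.
Let pi0 : pi 0 = 0 := rmorph0 _.

Let FD x y : F (x + y) = F x + F y.
Proof. by rewrite -[x in LHS]scale1r (psik_linear n2 pS) scale1r. Qed.

Let FZ (e : K) x : F (e *: x) = e *: F x.
Proof.
have F0 : F 0 = 0 by have := FD 0 0; rewrite addr0 => /eqP; rewrite -subr_eq subrr => /eqP.
by rewrite -[e *: x]addr0 (psik_linear n2 pS) F0 addr0.
Qed.

Lemma pi_gamma_beta (a : In) : \sum_(b : Out) pi (Gamma a b) * pi (arrow_elt K (val b)) = 0.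
Proof.
transitivity (pi (cyc_deriv (val a) S)); last exact/quotring_pi_eq0/jacobian_cyc_deriv.
rewrite -(sum_cyc_deriv2_arrow pS lf (eqP (valP a))) raddf_sum.
by apply: eq_bigr => b _; rewrite /= rmorphM.
Qed.

Lemma pi_alpha_gamma (b : Out) : \sum_(a : In) pi (arrow_elt K (val a)) * pi (Gamma a b) = 0.
Proof.
transitivity (pi (cyc_deriv (val b) S)); last exact/quotring_pi_eq0/jacobian_cyc_deriv.
rewrite -(sum_arrow_cyc_deriv2 pS lf (eqP (valP b))) raddf_sum.
by apply: eq_bigr => a _; rewrite /= rmorphM.
Qed.

Definition lstar s u := if s is Some b then ld (star_out b) u else u.
Definition rstar t u := if t is Some a then rd (star_in a) u else u.
(** The four kinds of matrix entries share one index scheme, so that a single product rule [blockM]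
    serves them all. *)
Definition block s t u := F (lstar s (rstar t u)).

Lemma lstar_rstar s t u : lstar s (rstar t u) = rstar t (lstar s u).
Proof. by case: s t => [b|] [a|] //=; rewrite ld_rd. Qed.

Lemma lstarM s x y :
  lstar s (x * y) = lstar s x * y + (isSome s)%:R * coef x k [::] *: lstar s y.
Proof.
case: s => [b|] /=; last by rewrite mul0r scale0r addr0.
by rewrite ldM /= (eqP (valP b)) mul1r.
Qed.

Lemma rstarM t x y :
  rstar t (x * y) = x * rstar t y + (isSome t)%:R * coef y k [::] *: rstar t x.
Proof.
case: t => [a|] /=; last by rewrite mul0r scale0r addr0.
by rewrite rdM /= (eqP (valP a)) mul1r.
Qed.

Lemma lstar_linear s : linear (lstar s).
Proof. by case: s => [b|] e x y //=; rewrite linearP. Qed.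

Lemma rstar_linear t : linear (rstar t).
Proof. by case: t => [a|] e x y //=; rewrite linearP. Qed.

HB.instance Definition _ s :=
  GRing.isLinear.Build K (cpa K Qm) (cpa K Qm) *:%R (lstar s) (lstar_linear s).

HB.instance Definition _ t :=
  GRing.isLinear.Build K (cpa K Qm) (cpa K Qm) *:%R (rstar t) (rstar_linear t).

Lemma blockP s t (e : K) x y : block s t (e *: x + y) = e *: block s t x + block s t y.
Proof. by rewrite /block linearP /= linearP /= FD FZ. Qed.

Lemma block0 s t : block s t 0 = 0.
Proof. by have := blockP s t (-1) 0 0; rewrite scaler0 addr0 scaleN1r addNr. Qed.

(** The last two terms come from the Leibniz rules of the two quotients and involve the coefficients
    at [e_k]. *)
Lemma blockM s t x y : block s t (x * y) =
  block s None x * block None t y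
  - \sum_(a : In) \sum_(b : Out) block s (Some a) x * Gamma a b * block (Some b) t y
  + (isSome t)%:R * coef y k [::] *: block s t x
  + (isSome s)%:R * coef x k [::] *: block s t y.
Proof.
rewrite {1}/block rstarM linearD linearZ /= lstarM !FD !FZ (psikM lf n2 pS) addrAC.
congr (_ - _ + _ + _).
by apply: eq_bigr => a _; apply: eq_bigr => b _; rewrite /block (lstar_rstar s (Some a)).
Qed.

Definition bhat s : cpa K Q := if s is Some b then arrow_elt K (val b) else 0.
Definition ahat t : cpa K Q := if t is Some a then arrow_elt K (val a) else 0.

(* The index [None] stands for the component [e_k^ M] of [Mbar].  The condition says
   that the matrix with entries [block s t u] sends [ker alpha] to [im beta] for every
   module over [jalg S]. *)
Definition negligible u := coef u k [::] = 0 /\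
  exists P C, forall s t, pi (block s t u) = pi (bhat s) * P t + C s * pi (ahat t).

Lemma pi_scale (e : K) (x : cpa K Q) : pi (e *: x) = pi (@cpa_const K Q e) * pi x.
Proof. by rewrite -rmorphM /cpa_const -cpa_scaleAl mul1r. Qed.

Lemma cpa_constC (e : K) (x : cpa K Q) : @cpa_const K Q e * x = x * @cpa_const K Q e.
Proof. by rewrite /cpa_const -cpa_scaleAl -cpa_scaleAr mul1r mulr1. Qed.

Lemma pi_constC (e : K) (w : jalg S) : pi (@cpa_const K Q e) * w = w * pi (@cpa_const K Q e).
Proof. by rewrite -[w]quotring_reprK -!piM cpa_constC. Qed.

Lemma isSome_bhat s (e : K) : (isSome s)%:R * e *: bhat s = e *: bhat s.
Proof. by case: s => [b|] /=; rewrite ?mul1r // !scaler0. Qed.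

Lemma isSome_ahat t (e : K) : (isSome t)%:R * e *: ahat t = e *: ahat t.
Proof. by case: t => [b|] /=; rewrite ?mul1r // !scaler0. Qed.

Lemma negligible0 : negligible 0.
Proof.
split; first exact: pa_coef0.
exists (fun=> 0), (fun=> 0) => s t.
by rewrite block0 rmorph0 mul0r mulr0 addr0.
Qed.

Lemma negligibleB x y : negligible x -> negligible y -> negligible (x - y).
Proof.
move=> [zx [P [C xE]]] [zy [P' [C' yE]]]; split.
  by rewrite pa_coefB zx zy subrr.
exists (fun t => P t - P' t), (fun s => C s - C' s) => s t.
rewrite addrC -scaleN1r blockP scaleN1r addrC rmorphB /= xE yE mulrBr mulrBl.
by rewrite opprD addrACA.
Qed.

(** The part of [u] with [P] survives only through the coefficient [z]: [bhat None] is zero, and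
    gamma beta = 0 in the Jacobian algebra. All other terms end in [ahat t] and are absorbed by the
    new [C]. *)
Lemma negligibleMl x u : negligible u -> negligible (x * u).
Proof.
move=> [zu [P [C uE]]]; split; first by rewrite pa_coefM big_ord1 zu mulr0.
pose z := coef x k [::].
exists (fun t => pi (@cpa_const K Q z) * P t).
exists (fun s => pi (block s None x) * C None
  - \sum_(a : In) \sum_(b : Out) pi (block s (Some a) x) * pi (Gamma a b) * C (Some b)
  + pi (@cpa_const K Q ((isSome s)%:R * z)) * C s) => s t.
rewrite blockM zu mulr0 scale0r addr0 piD piB piM uE /= pi0 mul0r add0r.
rewrite pi_scale uE mulrDr !mulrDl !mulrA addrC -addrA; congr (_ + _).
  rewrite -!piM; congr (pi _ * _); rewrite cpa_constC.
  by rewrite -/z /cpa_const -!cpa_scaleAr mulr1 isSome_bhat.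
rewrite mulNr addrC [X in _ = _ - X + _]mulr_suml; congr (_ - _ + _).
rewrite raddf_sum; apply: eq_bigr => a _; rewrite raddf_sum mulr_suml.
(* A summand that is zero by [pi_gamma_beta] is inserted to match the expansion of [uE]. *)
transitivity (pi (block s (Some a) x) *
    (\sum_(b : Out) pi (Gamma a b) * pi (arrow_elt K (val b))) * P t
  + \sum_(b : Out) pi (block s (Some a) x) * pi (Gamma a b) * C (Some b) * pi (ahat t));
  last first.
  by rewrite pi_gamma_beta mulr0 mul0r add0r.
rewrite mulr_sumr mulr_suml -big_split; apply: eq_bigr => b _ /=.
by rewrite !piM uE /= mulrDr !mulrA.
Qed.

(** Mirror image of the left case: [ahat None] is zero and alpha gamma = 0 removes the part with
    [C], up to the coefficient of [x] at [e_k]. *)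
Lemma negligibleMr x u : negligible u -> negligible (u * x).
Proof.
move=> [zu [P [C uE]]]; split; first by rewrite pa_coefM big_ord1 zu mul0r.
pose z := coef x k [::].
exists (fun t => P None * pi (block None t x)
  - \sum_(a : In) \sum_(b : Out) P (Some a) * pi (Gamma a b) * pi (block (Some b) t x)
  + P t * pi (@cpa_const K Q ((isSome t)%:R * z))).
exists (fun s => C s * pi (@cpa_const K Q z)) => s t.
rewrite blockM zu mulr0 scale0r addr0 piD piB piM uE /= pi0 mulr0 addr0.
rewrite pi_scale uE [in LHS]pi_constC mulrDl !mulrDr mulrN.
have -> : pi (\sum_(a : In) \sum_(b : Out)
      block s (Some a) u * Gamma a b * block (Some b) t x) =
    pi (bhat s) * \sum_(a : In) \sum_(b : Out)
      P (Some a) * pi (Gamma a b) * pi (block (Some b) t x).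
  rewrite mulr_sumr raddf_sum.
  transitivity (\sum_(a : In) pi (bhat s) * (\sum_(b : Out)
        P (Some a) * pi (Gamma a b) * pi (block (Some b) t x))
      + C s * \sum_(b : Out) (\sum_(a : In) pi (arrow_elt K (val a)) * pi (Gamma a b))
          * pi (block (Some b) t x)); last first.
    rewrite [X in _ + C s * X]big1 ?mulr0 ?addr0 // => b _.
    by rewrite pi_alpha_gamma mul0r.
  under [X in _ + C s * X]eq_bigr do rewrite mulr_suml.
  rewrite [X in _ + C s * X]exchange_big [X in _ + X]mulr_sumr -big_split.
  apply: eq_bigr => a _; rewrite /= raddf_sum !mulr_sumr -big_split.
  by apply: eq_bigr => b _; rewrite /= !piM uE /= !mulrDl !mulrA.
rewrite !addrA !mulrA; congr (_ + _).
rewrite -[in LHS]mulrA -[in RHS]mulrA -[in LHS]pi_constC -!piM; congr (_ * pi _).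
by rewrite /cpa_const -!cpa_scaleAl !mul1r isSome_ahat.
Qed.

Definition negligible_ideal : tsideal (cpa K Qm) :=
  TSIdeal negligible0 negligibleB negligibleMl negligibleMr.

End AnnihilatorIdeal.

(** * Linear compactness *)

Section LinearCompactness.
Variables (K : fieldType) (S : nat -> (nat -> K) -> Prop).
Hypothesis S_dec : forall n x, S n.+1 x -> S n x.
Hypothesis S_affine : forall n c x y w, S n x -> S n y -> S n w ->
  S n (fun i => x i + c * (y i - w i)).
Hypothesis S_ex : forall n, exists x, S n x.
Hypothesis S_finite : forall n, exists m, forall x y, S n x ->
  (forall i, (i < m)%N -> x i = y i) -> S n y.

Let good m (x : nat -> K) :=
  forall n, exists2 y, S n y & forall i, (i < m)%N -> y i = x i.

Let S_le m n x : (m <= n)%N -> S n x -> S m x.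
Proof.
move=> /subnK <-; elim: (n - m)%N => [|d IH] //; rewrite addSn => /S_dec; exact: IH.
Qed.

(* The values at [m] of the sequences in [S n] with prescribed values below [m] form
   a nonempty affine subspace of [K], decreasing in [n]: a point or all of [K]. *)
Let good_step m x : good m x -> exists c, good m.+1 (fun i => if i == m then c else x i).
Proof.
move=> gx; pose V n c := exists y, [/\ S n y, forall i, (i < m)%N -> y i = x i & y m = c].
have VE n c : V n c ->
    exists2 y, S n y & forall i, (i < m.+1)%N -> y i = if i == m then c else x i.
  move=> [y [Sy yx ym]]; exists y => // i; rewrite ltnS leq_eqVlt.
  by case: eqP => [->//|_ /= /yx].
have Vle n n' c : (n <= n')%N -> V n' c -> V n c.
  by move=> nn' [y [Sy yx ym]]; exists y; split=> //; apply: S_le Sy.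
have Vex n : exists c, V n c by have [y Sy yx] := gx n; exists (y m), y.
have [[n0 [c0 [Vc0 uc0]]]|nu] := pselect (exists n c, V n c /\ forall c', V n c' -> c' = c).
  exists c0 => n; apply: VE; have [c Vc] := Vex (maxn n n0).
  rewrite -(uc0 c); first by apply: Vle Vc; apply: leq_maxl.
  by apply: Vle Vc; apply: leq_maxr.
exists 0 => n; apply: VE; have [c Vc] := Vex n.
have [c' Vc' /eqP cc'] : exists2 c', V n c' & c' <> c.
  apply: contrapT => nc; apply: nu; exists n, c; split=> // c' Vc'.
  by apply: contrapT => cc'; apply: nc; exists c'.
have [y [Sy yx ym]] := Vc; have [y' [Sy' yx' ym']] := Vc'.
exists (fun i => y i + (- c / (c' - c)) * (y' i - y i)); split.
- exact: S_affine.
- by move=> i im; rewrite yx ?yx' // subrr mulr0 addr0.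
- by rewrite ym ym' divfK ?subrr // subr_eq0.
Qed.

(** Coordinates are fixed one at a time so that each prefix extends to a point of every [S n]; as
    [S n] looks at finitely many coordinates, the limit sequence lies in it. This is linear
    compactness of a countable power of an arbitrary field. *)
Lemma affine_tower_inhabited : exists x, forall n, S n x.
Proof.
have g0 : good 0 (fun=> 0) by move=> n; have [x Sx] := S_ex n; exists x.
pose step m (p : {x | good m x}) : {x | good m.+1 x} :=
  let c := cid (good_step (svalP p)) in
  exist (good m.+1) (fun i => if i == m then sval c else sval p i) (svalP c).
pose f := fix f m : {x | good m x} :=
  if m is m'.+1 then step m' (f m') else exist _ _ g0.
(* Coordinate [i] is chosen at stage [i.+1] and kept from then on. *)
pose x i := sval (f i.+1) i.
have fx m i : (i < m)%N -> sval (f m) i = x i.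
  elim: m => // m IH; rewrite ltnS leq_eqVlt => /orP[/eqP-> //|im].
  by rewrite -IH //= ltn_eqF.
exists x => n; have [m Sm] := S_finite n; have [y Sy yx] := svalP (f m) n.
by apply: Sm Sy _ => i im; rewrite yx // fx.
Qed.

End LinearCompactness.

HB.instance Definition _ (Q : quiver) := [Countable of qpath Q by <:].

Lemma pickle_path_bound (I : finType) (Q : quiver) n :
  exists m, forall (e : I) (q : qpath Q), (size (parr q) <= n)%N -> (pickle (e, q) < m)%N.
Proof.
pose r := [seq (j, s) | j <- enum (vert Q), s <- words Q n].
pose r' : seq (qpath Q) := pmap insub r.
exists (\max_(e : I) \max_(q <- r') (pickle (e, q))).+1 => e q qn; rewrite ltnS.
apply: leq_trans (leq_bigmax (F := fun e => \max_(q <- r') pickle (e, q)) e).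
apply: (@leq_bigmax_seq _ r' xpredT (fun q => pickle (e, q))) => //.
rewrite mem_pmap_sub; apply/allpairsP; exists (val q).
by rewrite mem_enum mem_words -surjective_pairing.
Qed.

(** * Closedness of the ideal of negligible elements *)

Section Closedness.
Variables (K : fieldType) (Q : quiver) (k : vert Q) (S : cpa K Q).
Hypotheses (lf : loop_free Q) (n2 : no_2cycle_at k) (pS : is_potential S).
Local Notation Qm := (mut k).
Local Notation pi := (quotring_pi (jacobian S)).
Local Notation In := (arrow_in k).
Local Notation Out := (arrow_out k).
Local Notation block := (@block K Q k S).
Local Notation bhat := (@bhat K Q k).
Local Notation ahat := (@ahat K Q k).
Implicit Types (u v : cpa K Qm) (s : option Out) (t : option In).

(** Each of the two quotients costs at most one degree, and [psik] halves the order. *)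
Lemma filt_block n s t u : filt n.*2.+2 u -> filt n (block s t u).
Proof.
move=> fu; apply: (filt_psik n2 pS).
have : filt n.*2.+1 (rstar t u).
  by case: t => [a|] /=; [apply: filt_rd | apply: filtS fu].
by case: s => [b|] /= ?; [apply: filt_ld | apply: (@filtS _ _ _ n.*2.+1)].
Qed.

(** The unknowns [P] and [C], lifted from the Jacobian algebra to series, are stored in one sequence
    of scalars through an enumeration of the paths. *)
Let code := ((option In + option Out) * qpath Q)%type.
Let row (x : nat -> K) t : cpa K Q := fun q => x (pickle ((inl t, q) : code)).
Let col (x : nat -> K) s : cpa K Q := fun q => x (pickle ((inr s, q) : code)).
Let comb x s t := bhat s * row x t + col x s * ahat t.

Let encode (P : option In -> cpa K Q) (C : option Out -> cpa K Q) : nat -> K := fun m =>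
  match (unpickle m : option code) with
  | Some (inl t, q) => P t q
  | Some (inr s, q) => C s q
  | None => 0
  end.

Lemma negligible_closed u :
  (forall n, exists2 v, negligible S v & filt n (u - v)) -> negligible S u.
Proof.
move=> cl; split.
  have [v [zv _] /(_ k [::])] := cl 1%N; rewrite pa_coefB zv subr0; exact.
pose T n x := forall s t, exists2 j, jacobian S j & filt n (block s t u - comb x s t - j).
have [||||x Tx] := @affine_tower_inhabited K T.
- move=> n x Tx s t; have [j Jj fj] := Tx s t; exists j => //; exact: filtS fj.
(* [comb] is linear in the unknowns while [block s t u] is fixed, and the errors in the Jacobian
   ideal combine in the same way. *)
- move=> n c x y w Tx Ty Tw s t.
  have [jx Jx fx] := Tx s t; have [jy Jy fy] := Ty s t; have [jw Jw fw] := Tw s t.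
  exists (jx + c *: (jy - jw)).
    apply: tsidealD => //; rewrite -[jy - jw]mul1r cpa_scaleAl.
    by apply: tsidealMl; apply: tsidealB.
  have rowE : row (fun i => x i + c * (y i - w i)) t =
      row x t + c *: (row y t - row w t) by [].
  have colE : col (fun i => x i + c * (y i - w i)) s =
      col x s + c *: (col y s - col w s) by [].
  have E : comb (fun i => x i + c * (y i - w i)) s t =
      comb x s t + c *: (comb y s t - comb w s t).
    rewrite /comb rowE colE mulrDr mulrDl -cpa_scaleAr -cpa_scaleAl addrACA.
    by rewrite -scalerDr mulrBr mulrBl opprD [in RHS]addrACA.
  have := filtD fx (filtZ c (filtB fy fw)); congr filt; rewrite E.
  set B := block s t u; set X := comb x s t; set Y := comb y s t; set W := comb w s t.
  have -> : B - Y - jy - (B - W - jw) = - (Y - W) - (jy - jw).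
    rewrite -[B - Y - jy]addrA -[B - W - jw]addrA -!opprD opprB [B - _]addrC addrACA.
    by rewrite subrr addr0 addrC -opprB opprD addrACA opprD.
  by rewrite scalerBr scalerN addrACA !opprD !addrA.
(* The order is the one that [filt_block] requires; lifts of the witnesses of the approximant [v]
   solve the equations at level [n]. *)
- move=> n; have [v [_ [P [C vE]]] fv] := cl n.*2.+2.
  pose P' t := repr (P t) : cpa K Q; pose C' s := repr (C s) : cpa K Q.
  have rowE t : row (encode P' C') t = P' t.
    by apply/funext => q; rewrite /row /encode pickleK.
  have colE s : col (encode P' C') s = C' s.
    by apply/funext => q; rewrite /col /encode pickleK.
  exists (encode P' C') => s t; exists (block s t v - comb (encode P' C') s t).
    apply/quotring_pi_eq0; rewrite /comb rowE colE rmorphB rmorphD !rmorphM /=.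
    by rewrite vE ![pi (repr _)]quotring_reprK subrr.
  have := filt_block s t fv; congr filt.
  by rewrite addrC -scaleN1r (blockP n2 pS) scaleN1r addrC opprB addrA subrK.
(* Modulo order [n], [comb] involves only the coefficients of the unknowns on paths shorter than
   [n]. *)
- move=> n; have [m mP] := @pickle_path_bound (option In + option Out)%type Q n.
  exists m => x y Tx xy s t; have [j Jj fj] := Tx s t; exists j => //.
  have fr : filt n (row x t - row y t).
    move=> i q qn; rewrite /coef; case: insubP => // p _ E.
    rewrite -[(_ - _) p]/(x _ - y _) xy ?subrr // mP //; apply: ltnW.
    by rewrite /parr E.
  have fc : filt n (col x s - col y s).
    move=> i q qn; rewrite /coef; case: insubP => // p _ E.
    rewrite -[(_ - _) p]/(x _ - y _) xy ?subrr // mP //; apply: ltnW.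
    by rewrite /parr E.
  have := filtD fj (filtD (filtMl (bhat s) fr) (filtMr (ahat t) fc)); congr filt.
  rewrite mulrBr mulrBl [X in _ + X]addrACA -opprD -/(comb x s t) -/(comb y s t).
  by rewrite [_ - comb x s t - j]addrAC addrA subrK addrAC.
(* The Jacobian ideal is closed, so solving the equations modulo it at every order solves them in
   [jalg S]. *)
exists (fun t => pi (row x t)), (fun s => pi (col x s)) => s t.
apply/eqP; rewrite -subr_eq0 -!rmorphM -rmorphD -rmorphB; apply/eqP/quotring_pi_eq0.
by apply: jacobian_closed => n; have [j Jj fj] := Tx n s t; exists j.
Qed.

End Closedness.

(** * Negligibility of the Jacobian ideal *)

Section Generators.
Variables (K : fieldType) (Q : quiver) (k : vert Q) (S S' : cpa K Q).
Hypotheses (lf : loop_free Q) (n2 : no_2cycle_at k) (pS : is_potential S).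
Hypotheses (SS' : cyc_equiv S S') (kS' : no_cycle_at k S').
Local Notation Qm := (mut k).
Local Notation pi := (quotring_pi (jacobian S)).
Local Notation In := (arrow_in k).
Local Notation Out := (arrow_out k).
Local Notation F := (@psik K Q k S).
Local Notation block := (@block K Q k S).
Local Notation bhat := (@bhat K Q k).
Local Notation ahat := (@ahat K Q k).
Local Notation "[* c ]" := (@arrow_elt K Qm c).
Implicit Types (u v : cpa K Qm) (s : option Out) (t : option In).

Lemma cyc_deriv_equiv c : cyc_deriv c S' = cyc_deriv c S.
Proof. by apply/funext => q; rewrite !cyc_derivE (cyc_equivE _ SS'). Qed.

Lemma cyc_deriv2_equiv b a : cyc_deriv2 b a S' = cyc_deriv2 b a S.
Proof. by apply/funext => q; rewrite !cyc_deriv2E (cyc_equivE _ SS'). Qed.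

Lemma star_neq (a : In) (b : Out) : (star_in a == star_out b :> arr Qm) = false.
Proof.
apply/eqP => -[E]; apply: (lf (a := val a)).
by rewrite (eqP (valP a)) (E : val a = val b) (eqP (valP b)).
Qed.

Lemma keep_neq (c : arrow_off k) :
  ((forall x, (Star x == Keep c :> arr Qm) = false) *
   (forall b a, (Comp b a == Keep c :> arr Qm) = false))%type.
Proof. by split=> *; apply/eqP. Qed.

Lemma comp_star_neq x b a : ((Star x == Comp b a :> arr Qm) = false) *
  ((Comp b a == Star x :> arr Qm) = false).
Proof. by split; apply/eqP. Qed.

Lemma star_in_inj : injective (@star_in Q k).
Proof. by move=> a a' [E]; apply: val_inj. Qed.

Lemma star_out_inj : injective (@star_out Q k).
Proof. by move=> a a' [E]; apply: val_inj. Qed.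

Let F0 : F 0 = 0.
Proof. by rewrite -[RHS](block0 n2 pS None None). Qed.

(** No starred arrow occurs, so only the entry without quotients can be nonzero, and there [psik]
    returns [u], which is zero in [jalg S]. *)
Lemma negligible_bracket (u : cpa K Q) :
  hat_supported k u -> jacobian S u -> negligible S (bracket u : cpa K Qm).
Proof.
move=> hu Ju; split.
  rewrite coef_bracket /=; apply/eqP/negPn/negP => /hu; by rewrite eqxx.
exists (fun=> 0), (fun=> 0) => s t; rewrite mulr0 mul0r addr0.
case: s => [b|]; first by rewrite /block lstar_rstar /= ld_bracket_star linear0 F0 rmorph0.
case: t => [a|]; first by rewrite /block /= rd_bracket_star F0 rmorph0.
by rewrite /block /= psik_bracket //; apply/quotring_pi_eq0.
Qed.

Lemma hat_supported_cyc_deriv c : hd c != k -> tl c != k ->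
  hat_supported k (cyc_deriv c S).
Proof.
move=> hc tc i s ne; rewrite (cyc_deriv_ptl pS ne) hc andbT.
move: ne; rewrite coef_cyc_deriv; case: ifP => _; last by rewrite eqxx.
by have [-> //|_] := eqVneq i (tl c); rewrite mul0r eqxx.
Qed.

Lemma hat_supported_cyc_deriv2 (b : Out) (a : In) :
  hat_supported k (cyc_deriv2 (val b) (val a) S).
Proof.
move=> i s ne; rewrite (cyc_deriv2_ptl pS ne) (hd_out_neq lf) andbT.
move: ne; rewrite coef_cyc_deriv2; case: ifP => _; last by rewrite eqxx.
have [->|_] := eqVneq i (tl (val a)); last by rewrite mul0r eqxx.
by rewrite (tl_in_neq lf).
Qed.

Lemma negligible_keep (c : arrow_off k) :
  negligible S (cyc_deriv (Keep c : arr Qm) (mut_potential k S')).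
Proof.
rewrite cyc_deriv_mut_potential big1 ?addr0 => [|b _]; last first.
  by rewrite big1 // => a _; rewrite cyc_deriv_mut_triangle !keep_neq !addr0.
rewrite cyc_deriv_bracket_keep // cyc_deriv_equiv.
have /andP[hc tc] := valP c.
apply: negligible_bracket (jacobian_cyc_deriv _ _); exact: hat_supported_cyc_deriv.
Qed.

(** The derivative is the bracketed second derivative of [S] plus [a^* b^*]. The minus sign in [psi]
    makes their values opposite. *)
Lemma negligible_comp (b : Out) (a : In) :
  negligible S (cyc_deriv (Comp b a : arr Qm) (mut_potential k S')).
Proof.
rewrite cyc_deriv_mut_potential cyc_deriv_bracket_comp // cyc_deriv2_equiv.
rewrite (bigD1 b) //= [X in _ + (_ + X)]big1 ?addr0 => [|b' ne]; last first.
  rewrite big1 // => a' _; rewrite cyc_deriv_mut_triangle.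
  case: (Comp b' a' =P Comp b a) => [[E _]|_]; first by rewrite E eqxx in ne.
  by rewrite !comp_star_neq !addr0.
rewrite (bigD1 a) //= [X in _ + (_ + X)]big1 ?addr0 => [|a' ne]; last first.
  rewrite cyc_deriv_mut_triangle; case: (Comp b a' =P Comp b a) => [[E]|_].
    by rewrite E eqxx in ne.
  by rewrite !comp_star_neq !addr0.
rewrite cyc_deriv_mut_triangle eqxx !comp_star_neq  add0r addr0.
set g := bracket _ + _.
have hu := @hat_supported_cyc_deriv2 b a.
split.
  rewrite pa_coefD coef_arrowM0 addr0 coef_bracket /=.
  by apply/eqP/negPn/negP => /hu; rewrite eqxx.
exists (fun=> 0), (fun=> 0) => s t; rewrite mulr0 mul0r addr0.
case: s => [b'|].
  rewrite /block lstar_rstar /= linearD /= ld_bracket_star add0r ldM ld_arrow.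
  by rewrite eq_sym star_neq scale0r mul0r add0r coef_arrow andbF scale0r linear0 F0 rmorph0.
case: t => [a'|].
  rewrite /block /= linearD /= rd_bracket_star add0r rdM rd_arrow.
  by rewrite star_neq scale0r mulr0 add0r coef_arrow andbF scale0r F0 rmorph0.
rewrite /block /= /g; have := blockP n2 pS None None 1 (bracket (cyc_deriv2 (val b) (val a) S))
  ([* star_in a ] * [* star_out b ]).
rewrite !scale1r /block /= => ->.
by rewrite psik_bracket // psik_star_star // subrr rmorph0.
Qed.

Lemma cyc_deriv_star_in (a : In) : cyc_deriv (star_in a : arr Qm) (mut_potential k S') =
  \sum_(b : Out) [* star_out b ] * [* Comp b a ].
Proof.
rewrite cyc_deriv_mut_potential cyc_deriv_bracket_star // add0r.
apply: eq_bigr => b _; rewrite (bigD1 a) //= big1 ?addr0 => [|a' ne]; last first.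
  rewrite cyc_deriv_mut_triangle [star_out b == _]eq_sym star_neq (inj_eq star_in_inj) (negPf ne).
  by rewrite comp_star_neq !addr0.
by rewrite cyc_deriv_mut_triangle [star_out b == _]eq_sym star_neq eqxx comp_star_neq  !add0r.
Qed.

Lemma cyc_deriv_star_out (b : Out) : cyc_deriv (star_out b : arr Qm) (mut_potential k S') =
  \sum_(a : In) [* Comp b a ] * [* star_in a ].
Proof.
rewrite cyc_deriv_mut_potential cyc_deriv_bracket_star // add0r.
rewrite (bigD1 b) //= [X in _ + X]big1 ?addr0 => [|b' ne]; last first.
  rewrite big1 // => a _.
  by rewrite cyc_deriv_mut_triangle star_neq (inj_eq star_out_inj) (negPf ne) comp_star_neq !addr0.
apply: eq_bigr => a _.
by rewrite cyc_deriv_mut_triangle star_neq eqxx comp_star_neq  !addr0.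
Qed.

(** The left quotient by [b^*] is [[ba]], with value [b a]; this is the entry of beta P for
    [P None = a]. *)
Lemma negligible_star_in (a : In) :
  negligible S (cyc_deriv (star_in a : arr Qm) (mut_potential k S')).
Proof.
rewrite cyc_deriv_star_in; split.
  by rewrite pa_coef_sum big1 // => b _; apply: coef_arrowM0.
exists (fun t => if t is Some _ then 0 else pi (arrow_elt K (val a))), (fun=> 0) => s t.
rewrite mul0r addr0; case: t => [a'|].
  rewrite /block /= linear_sum big1 => [|b _] /=.
    by rewrite linear0 F0 rmorph0 mulr0.
  by rewrite rdM rd_arrow comp_star_neq scale0r mulr0 add0r coef_arrow andbF scale0r.
rewrite /block /=; case: s => [b|] /=; last first.
  rewrite rmorph0 mul0r psik_hd0 ?rmorph0 // => i s ik.
  rewrite pa_coef_sum big1 // => b _; case: s => [|c s]; first exact: coef_arrowM0.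
  by rewrite coef_arrowM /= (eqP (valP b)) (negPf ik) mul0r.
rewrite linear_sum (bigD1 b) //= big1 ?addr0 => [|b' ne]; last first.
  rewrite ldM ld_arrow (inj_eq star_out_inj) [b == b']eq_sym (negPf ne) scale0r mul0r add0r.
  by rewrite coef_arrow andbF scale0r.
rewrite ldM ld_arrow eqxx scale1r coef_arrow andbF scale0r addr0 /=.
by rewrite idem_arrow eqxx scale1r psik_comp // rmorphM.
Qed.

(** The right quotient by [a^*] is [[ba]], with value [b a]; this is the entry of C alpha for
    [C None = b]. *)
Lemma negligible_star_out (b : Out) :
  negligible S (cyc_deriv (star_out b : arr Qm) (mut_potential k S')).
Proof.
rewrite cyc_deriv_star_out; split.
  by rewrite pa_coef_sum big1 // => a _; apply: coef_arrowM0.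
exists (fun=> 0), (fun s => if s is Some _ then 0 else pi (arrow_elt K (val b))) => s t.
rewrite mulr0 add0r; case: s => [b'|].
  rewrite /block lstar_rstar /= linear_sum big1 => [|a _] /=.
    by rewrite linear0 F0 rmorph0 mul0r.
  by rewrite ldM ld_arrow comp_star_neq scale0r mul0r add0r coef_arrow andbF scale0r.
rewrite /block /=; case: t => [a|] /=; last first.
  rewrite rmorph0 mulr0 psik_tl0 ?rmorph0 // => i s.
  apply: contraNeq; case/lastP: s => [|s c].
    by rewrite pa_coef_sum big1 ?eqxx // => a _; apply: coefM_arrow0.
  rewrite ptl_rcons; apply: contraNeq => ck.
  rewrite pa_coef_sum big1 // => a _; rewrite coefM_arrow.
  case: (c =P star_in a) => [E|_]; last by rewrite andbF mul0r.
  by move: ck; rewrite E /= (eqP (valP a)) eqxx.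
rewrite linear_sum (bigD1 a) //= big1 ?addr0 => [|a' ne]; last first.
  rewrite rdM rd_arrow (inj_eq star_in_inj) [a == a']eq_sym (negPf ne) scale0r mulr0 add0r.
  by rewrite coef_arrow andbF scale0r.
rewrite rdM rd_arrow eqxx scale1r coef_arrow andbF scale0r addr0 /=.
by rewrite arrow_idem eqxx scale1r psik_comp // rmorphM.
Qed.

Lemma negligible_generator c :
  negligible S (cyc_deriv (c : arr Qm) (mut_potential k S')).
Proof.
case: c => [c|b a|c]; [exact: negligible_keep|exact: negligible_comp|].
have [ck|ck] := boolP (hd (val c) == k).
  have -> : Star c = star_in (exist _ (val c) ck) by congr Star; apply: val_inj.
  exact: negligible_star_in.
have ck' : tl (val c) == k by move: (valP c); rewrite (negPf ck).
have -> : Star c = star_out (exist _ (val c) ck') by congr Star; apply: val_inj.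
exact: negligible_star_out.
Qed.

Lemma negligible_jacobian u : jacobian (mut_potential k S') u -> negligible S u.
Proof.
move=> Ju; apply: negligible_closed => // n.
have [v Iv /ideal_pow_filt fv] := Ju n; exists v => //.
apply: (Iv (negligible_ideal lf n2 pS)) => _ [c _ <-].
exact: negligible_generator.
Qed.

End Generators.

(** * Negligible elements act as zero *)

Section Subspaces.
Variables (K : pzRingType) (V : lmodType K) (U : subspace V).

Lemma in_subspK x : U x -> val (in_subsp U x) = x.
Proof. by move=> Ux; apply: insubdK; apply/asboolP. Qed.

Lemma subspaceE (x : subsp U) : U (val x).
Proof. exact/asboolP/(valP x). Qed.

Lemma subspaceD x y : U x -> U y -> U (x + y).
Proof. by move=> Ux Uy; rewrite -[x]scale1r; apply: subspaceP. Qed.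

Lemma subspaceN x : U x -> U (- x).
Proof.
by move=> Ux; rewrite -scaleN1r -[_ *: _]addr0; apply: subspaceP => //; apply: subspace0.
Qed.

Lemma subspace_sum (I : Type) (r : seq I) (P : pred I) (f : I -> V) :
  (forall i, P i -> U (f i)) -> U (\sum_(i <- r | P i) f i).
Proof. by move=> Uf; apply: big_ind => //; [exact: subspace0 | exact: subspaceD]. Qed.

Lemma in_subspD x y : U x -> U y -> in_subsp U (x + y) = in_subsp U x + in_subsp U y.
Proof.
move=> Ux Uy; apply: val_inj; rewrite in_subspK; last exact: subspaceD.
by rewrite raddfD /= !in_subspK.
Qed.

Lemma in_subsp0 : in_subsp U 0 = 0.
Proof. by apply: val_inj; rewrite in_subspK ?raddf0 //; apply: subspace0. Qed.

Lemma in_subsp_sum (I : Type) (r : seq I) (f : I -> V) :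
  (forall i, U (f i)) -> in_subsp U (\sum_(i <- r) f i) = \sum_(i <- r) in_subsp U (f i).
Proof.
move=> Uf; elim: r => [|i r IH]; first by rewrite !big_nil in_subsp0.
by rewrite !big_cons in_subspD ?IH //; apply: subspace_sum.
Qed.

Lemma quotsp_pi_eq0 x : U x -> quotsp_pi U x = 0.
Proof.
move=> Ux; have E : (x - 0 \in subspace_pred U) = (quotsp_pi U x == quotsp_pi U 0).
  by rewrite Quotient.idealrBE.
have <- : quotsp_pi U 0 = 0.
  by apply: (addrI (quotsp_pi U 0)); rewrite -quotsp_piD !addr0.
by apply/eqP; rewrite -E subr0; apply/asboolP.
Qed.

End Subspaces.

Lemma pair_sum (V W : nmodType) (I : Type) (r : seq I) (f : I -> V) :
  \sum_(i <- r) (f i, 0) = (\sum_(i <- r) f i, 0) :> (V * W)%type.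
Proof.
by elim: r => [|i r IH]; rewrite ?big_nil // !big_cons IH; congr (_, _); apply: addr0.
Qed.

Lemma sum_pair (V W : nmodType) (I : Type) (r : seq I) (f : I -> W) :
  \sum_(i <- r) (0, f i) = (0, \sum_(i <- r) f i) :> (V * W)%type.
Proof.
by elim: r => [|i r IH]; rewrite ?big_nil // !big_cons IH; congr (_, _); apply: addr0.
Qed.

Section DecoratedRepresentation.
Variables (K : fieldType) (Q : quiver) (k : vert Q) (S : cpa K Q).
Hypotheses (lf : loop_free Q) (n2 : no_2cycle_at k) (pS : is_potential S).
Variable M : lmodType (jalg S).
Local Notation Qm := (mut k).
Local Notation pi := (quotring_pi (jacobian S)).
Local Notation In := (arrow_in k).
Local Notation Out := (arrow_out k).
Local Notation F := (@psik K Q k S).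
Local Notation block := (@block K Q k S).
Local Notation kM := (kmod M).
Implicit Types (u v : cpa K Qm) (x y : cpa K Q) (m : kM).

Lemma actM x y m : act (x * y) m = act x (act y m).
Proof. by rewrite /act rmorphM scalerA. Qed.

Lemma act_sum (I : Type) (r : seq I) (f : I -> cpa K Q) m :
  act (\sum_(i <- r) f i) m = \sum_(i <- r) act (f i) m.
Proof. by rewrite /act raddf_sum scaler_suml. Qed.

Lemma act0 x m : pi x = 0 -> act x m = 0.
Proof. by rewrite /act => ->; rewrite scale0r. Qed.

Lemma Mvert_act j x m : idem K j * x = x -> Mvert M j (act x m).
Proof. by move=> <-; exists (act x m) => //; apply: actM. Qed.

Lemma Mhat_Mvert j m : j != k -> Mvert M j m -> Mhat k M m.
Proof.
move=> jk [m' _ ->]; exists (act (idem K j) m') => //.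
by rewrite /= -actM mulrBl mul1r idemM eq_sym (negPf jk) scale0r subr0.
Qed.

Lemma psik_idem0 u : idem K k * F u = 0.
Proof.
rewrite (psik_rec n2 pS) mulrDr !mulr_sumr.
rewrite big1 ?add0r => [|i _]; last first.
  by rewrite -cpa_scaleAr idemM eq_sym (negPf (valP i)) scale0r scaler0.
rewrite big1 // => z _; rewrite -psi_arrow_hd !mulrA idemM eq_sym.
by rewrite (negPf (valP (hd z))) scale0r !mul0r.
Qed.

Lemma Mhat_psik u m : Mhat k M (act (F u) m).
Proof. by exists (act (F u) m) => //; rewrite /= -actM mulrBl mul1r psik_idem0 subr0. Qed.

Lemma psik_idemM j u : j != k -> F (@idem K Qm j * u) = idem K j * F u.
Proof.
move=> jk; rewrite (psikM lf n2 pS) psik_idem // big1 ?subr0 // => a _.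
rewrite big1 // => b _.
have -> : rd (star_in a) (@idem K Qm j) = 0.
  apply: coef_inj => i s; rewrite coef_rd coef_idem pa_coef0.
  by case: s => [|? ?]; rewrite andbF.
by have := block0 n2 pS None None; rewrite /block /= => ->; rewrite !mul0r.
Qed.

Lemma psik_comp_hat u : F (comp_hat u) = block None None u.
Proof.
apply: psik_ext => i s ik sk; rewrite /comp_hat mulrBl mul1r mulrBr mulr1.
rewrite !pa_coefB coef_idemM coefM_idem pa_coefB coef_idemM.
by rewrite (negPf ik) (negPf sk) !mul0r !subr0.
Qed.

Lemma psik_comp_v u (a : In) : F (comp_v u a) = block None (Some a) u.
Proof.
apply: psik_ext => i s ik _; rewrite coef_rd.
rewrite -[comp_v u a]/(fun q : qpath Qm => (fun (i : vert Qm) s => if i == k then 0 else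
  coef u i (rcons s (star_in a))) (phd q) (parr q)) coef_fun (negPf ik).
by case: ifPn => // nwf; rewrite coef_nwf // wfp_rcons (negPf nwf).
Qed.

(** [comp_w] may contain trivial paths at vertices other than the head of [b]. The idempotent
    removes them, and [eta_star_out] applies it too. *)
Lemma psik_comp_w u (b : Out) :
  idem K (hd (val b)) * F (comp_w u b) = block (Some b) None u.
Proof.
rewrite -psik_idemM ?hd_out_neq //; apply: psik_ext => i s ik sk.
rewrite coef_idemM coef_ld /= (eqP (valP b)).
rewrite -[comp_w u b]/(fun q : qpath Qm => (fun (i : vert Qm) (s : seq (arr Qm)) =>
  if ptl i s == k then 0 else coef u k (star_out b :: s)) (phd q) (parr q)) coef_fun (negPf sk).
case: eqP => [->|]; rewrite ?mul0r // mul1r.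
case: ifPn => // nwf; rewrite coef_nwf //= (eqP (valP b)) eqxx //.
Qed.

Lemma psik_comp_x u (b : Out) (a : In) :
  idem K (hd (val b)) * F (comp_x u b a) = block (Some b) (Some a) u.
Proof.
rewrite -psik_idemM ?hd_out_neq //; apply: psik_ext => i s ik sk.
rewrite coef_idemM coef_ld coef_rd /= (eqP (valP b)).
rewrite -[comp_x u b a]/(fun q : qpath Qm => (fun (_ : vert Qm) (s : seq (arr Qm)) =>
  coef u k (star_out b :: rcons s (star_in a))) (phd q) (parr q)) coef_fun.
case: eqP => [->|]; rewrite ?mul0r // mul1r.
case: ifPn => // nwf; rewrite coef_nwf //= (eqP (valP b)) eqxx /=.
by rewrite wfp_rcons (negPf nwf).
Qed.

Lemma gammaD : {morph (@gamma K Q S k M) : y y' / y + y'}.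
Proof.
move=> y y'; apply/ffunP => a; rewrite !ffunE -big_split; apply: eq_bigr => b _.
by rewrite ffunE linearD.
Qed.

Lemma gamma_beta m : gamma (beta k m) = 0 :> {ffun In -> kM}.
Proof.
apply/ffunP => a; rewrite !ffunE.
under eq_bigr do rewrite ffunE -actM.
rewrite -act_sum act0 // raddf_sum -[RHS](pi_gamma_beta lf pS a).
by apply: eq_bigr => b _; rewrite /= rmorphM.
Qed.

Lemma alpha_gamma (y : {ffun Out -> kM}) : alpha (gamma y : {ffun In -> kM}) = 0.
Proof.
rewrite /alpha; under eq_bigr do rewrite ffunE linear_sum /=.
rewrite exchange_big big1 // => b _ /=; under eq_bigr do rewrite -actM.
rewrite -act_sum act0 // raddf_sum -[RHS](pi_alpha_gamma lf pS b).
by apply: eq_bigr => a _; rewrite /= rmorphM.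
Qed.

Lemma Min_gamma (y : {ffun Out -> kM}) : Min k M (gamma y).
Proof.
move=> a; rewrite ffunE; apply: subspace_sum => b _.
by apply: Mvert_act; rewrite cyc_deriv2_hd.
Qed.

Lemma Mout_beta m : Mout k M (beta k m).
Proof. by move=> b; rewrite ffunE; apply: Mvert_act; rewrite idem_arrow eqxx scale1r. Qed.

Lemma Mout_inj_out (b : Out) m : Mvert M (hd (val b)) m -> Mout k M (inj_out b m).
Proof. by move=> Mm b'; rewrite ffunE; case: eqP => [->|_] //; apply: subspace0. Qed.

Section Annihilation.
Variables (Mk : lmodType K) (alphabar : subsp (Mout k M) -> Mk).
Variable (betabar : Mk -> subsp (Min k M)).
Hypothesis alphabarD : {morph alphabar : y y' / y + y'}.
Hypothesis alphabar_beta : forall m, Mvert M k m ->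
  alphabar (in_subsp (Mout k M) (beta k m)) = 0.
Hypothesis alpha_betabar : forall w, alpha (val (betabar w)) = 0.

(** Every term with [C] contains alpha of [betabar x.2], which is zero. The terms with [P] assemble
    to [beta] of a single vector of M_k, which [alphabar] kills. *)
Lemma eta_tilde_negligible u (x : Mbar k M Mk) :
  negligible S u -> eta_tilde alphabar betabar u x = 0.
Proof.
move=> [zu [P [C uE]]].
have alphabar0 : alphabar 0 = 0.
  by apply: (addrI (alphabar 0)); rewrite -alphabarD !addr0.
have alphabar_sum (I : Type) (r : seq I) (f : I -> subsp (Mout k M)) :
    \sum_(i <- r) alphabar (f i) = alphabar (\sum_(i <- r) f i).
  by rewrite (big_morph alphabar alphabarD alphabar0).
pose y1 : kM := val x.1; pose y2 : {ffun In -> kM} := val (betabar x.2).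
have y2M a : Mhat k M (y2 a).
  apply: Mhat_Mvert (subspaceE (betabar x.2) a); exact: tl_in_neq.
have act_block s t m : act (block s t u) m =
    pi (bhat K s) *: (P t *: (m : M)) + C s *: (pi (ahat K t) *: (m : M)).
  by rewrite /act uE scalerDl !scalerA.
have alpha0 : \sum_(a : In) pi (arrow_elt K (val a)) *: (y2 a : M) = 0.
  exact: alpha_betabar.
rewrite /eta_tilde /comp_z zu.
have -> : eta_idem 0 x = 0 by rewrite /eta_idem scale0r.
rewrite add0r.
have -> : Theta (comp_hat u) x = 0.
  rewrite /Theta -/(psik S (comp_hat u)) psik_comp_hat act_block /= rmorph0.
  by rewrite !scale0r scaler0 addr0 in_subsp0.
rewrite add0r.
have -> : \sum_(a : In) Theta (comp_v u a) (eta_star_in betabar a x) = 0.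
  pose g (a : In) : kM := act (block None (Some a) u) (y2 a).
  have gM a : Mhat k M (g a) by rewrite /g -psik_comp_v; apply: Mhat_psik.
  transitivity (\sum_(a : In) ((in_subsp (Mhat k M) (g a), 0) : Mbar k M Mk)).
    apply: eq_bigr => a _; rewrite /Theta /eta_star_in /= in_subspK //.
    by rewrite -/(psik S (comp_v u a)) psik_comp_v.
  rewrite pair_sum -in_subsp_sum //.
  have -> : \sum_a g a = 0.
    under eq_bigr => a _ do rewrite /g act_block /= rmorph0 scale0r add0r.
    have CE : \sum_(a : In) C None *: (pi (arrow_elt K (val a)) *: (y2 a : M)) = 0.
      by rewrite -scaler_sumr alpha0 scaler0.
    exact: CE.
  by rewrite in_subsp0.
rewrite add0r.
pose W (b : Out) : kM := act (block (Some b) None u) y1.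
pose X (b : Out) (a : In) : kM := act (block (Some b) (Some a) u) (y2 a).
have WM b : Mvert M (hd (val b)) (W b).
  apply: Mvert_act; rewrite -psik_comp_w mulrA idemM eqxx scale1r //.
have XM b a : Mvert M (hd (val b)) (X b a).
  apply: Mvert_act; rewrite -psik_comp_x mulrA idemM eqxx scale1r //.
have -> : \sum_(b : Out) eta_star_out alphabar b (Theta (comp_w u b) x) =
    \sum_(b : Out) (0, alphabar (in_subsp (Mout k M) (inj_out b (W b)))).
  apply: eq_bigr => b _; rewrite /eta_star_out /Theta /=.
  congr (_, alphabar (in_subsp _ (inj_out _ _))).
  by rewrite -/(psik S (comp_w u b)) in_subspK -?actM ?psik_comp_w //; apply: Mhat_psik.
have -> : \sum_(b : Out) \sum_(a : In)
      eta_star_out alphabar b (Theta (comp_x u b a) (eta_star_in betabar a x)) =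
    \sum_(b : Out) \sum_(a : In) (0, alphabar (in_subsp (Mout k M) (inj_out b (X b a)))).
  apply: eq_bigr => b _; apply: eq_bigr => a _; rewrite /eta_star_out /Theta /=.
  congr (_, alphabar (in_subsp _ (inj_out _ _))).
  rewrite -/(psik S (comp_x u b a)) (in_subspK (y2M a)).
  by rewrite in_subspK -?actM ?psik_comp_x //; apply: Mhat_psik.
under [X in _ + X]eq_bigr do rewrite sum_pair.
rewrite !sum_pair.
set A1 := \sum_(b : Out) alphabar _; set A2 := \sum_(b : Out) \sum_(a : In) alphabar _.
transitivity ((0 + 0, A1 + A2) : Mbar k M Mk); first by [].
suff -> : A1 + A2 = 0 by rewrite addr0.
(* All contributions are gathered in one argument of [alphabar], since the vanishing concerns whole
   vectors [beta m] and not their components. *)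
pose Y := \sum_(b : Out) (inj_out b (W b) + \sum_(a : In) inj_out b (X b a)).
have YM b : Mout k M (\sum_(a : In) inj_out b (X b a)).
  by apply: subspace_sum => a _; apply: Mout_inj_out.
have -> : A1 + A2 = alphabar (in_subsp (Mout k M) Y).
  rewrite in_subsp_sum => [|b]; last first.
    by apply: subspaceD => //; apply: Mout_inj_out.
  rewrite -alphabar_sum /A1 /A2 -big_split; apply: eq_bigr => b _ /=.
  rewrite in_subspD ?alphabarD //; last exact: Mout_inj_out.
  rewrite in_subsp_sum ?alphabar_sum // => a; exact: Mout_inj_out.
pose m0 : kM := P None *: (y1 : M) + \sum_(a : In) P (Some a) *: (y2 a : M).
(* [m0] may lie outside M_k; projecting it changes nothing because every [b] starts at [k]. *)
suff -> : Y = beta k (act (idem K k) m0) by apply: alphabar_beta; exists m0.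
apply/ffunP => b; rewrite /Y sum_ffunE ffunE.
have inj_out_diag (b' : Out) m : inj_out b' m b = if b' == b then m else 0.
  by rewrite ffunE eq_sym.
have entry b' : (inj_out b' (W b') + \sum_a inj_out b' (X b' a)) b =
    if b' == b then W b + \sum_a X b a else 0.
  rewrite ffunE sum_ffunE inj_out_diag; case: eqP => [->|ne].
    by congr (_ + _); apply: eq_bigr => a _; rewrite inj_out_diag eqxx.
  by rewrite big1 ?addr0 // => a _; rewrite inj_out_diag; case: eqP.
rewrite (eq_bigr _ (fun b' _ => entry b')) -big_mkcond big_pred1_eq.
rewrite -actM arrow_idem (eqP (valP b)) eqxx scale1r.
rewrite /W /X act_block /= rmorph0 scale0r scaler0 addr0.
under eq_bigr do rewrite act_block /=.
rewrite big_split /=.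
have CE : \sum_(a : In) C (Some b) *: (pi (arrow_elt K (val a)) *: (y2 a : M)) = 0.
  by rewrite -scaler_sumr alpha0 scaler0.
rewrite [X in _ + (_ + X)]CE addr0 /act scalerDr; congr (_ + _).
by rewrite scaler_sumr.
Qed.

End Annihilation.

(** * The three descriptions of the mutated module *)

Section Descriptions.
Variable V : lmodType {ffun vert Q -> K}.
Variables (rho : {linear subsp (Mout k M) -> subsp (ker_gamma k M)}).
Hypothesis rhoP : is_retraction rho.
Variables (sigma : {linear ker_alpha_mod_im_gamma k M -> subsp (ker_alpha k M)}).

(** Since [beta m] lies in ker gamma, the retraction fixes it, and its class modulo im beta is
    zero. *)
Lemma rho_beta m : Mvert M k m ->
  quotsp_pi (subsp_in (ker_gamma k M) (im_beta k M))
    (rho (in_subsp (Mout k M) (beta k m))) = 0.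
Proof.
move=> Mm; have E := in_subspK (Mout_beta m).
apply: quotsp_pi_eq0; rewrite /= rhoP E; first by exists m.
by split; [apply: Mout_beta | apply: gamma_beta].
Qed.

Lemma im_gamma_gamma (y : subsp (Mout k M)) : im_gamma k M (- gamma (val y)).
Proof. by apply: subspaceN; exists (val y) => //; apply: subspaceE. Qed.

Lemma ker_alpha_gamma (y : {ffun Out -> kM}) : ker_alpha k M (gamma y).
Proof. by split; [apply: Min_gamma | apply: alpha_gamma]. Qed.

Lemma ker_alpha_N_gamma (y : {ffun Out -> kM}) : ker_alpha k M (- gamma y).
Proof. exact/subspaceN/ker_alpha_gamma. Qed.

Lemma eta_tildeA_negligible u (x : Mbar k M (MbarA k M V)) :
  negligible S u -> eta_tildeA V rho sigma u x = 0.
Proof.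
apply: eta_tilde_negligible => [y y'|m Mm|[[[w1 w2] w3] w4]] /=.
- have rhoD : rho (y + y') = rho y + rho y' by apply: linearD.
  have valD : val (y + y') = val y + val y' by [].
  rewrite /alphabarA rhoD valD gammaD quotsp_piD !opprD in_subspD;
    do ?[exact: im_gamma_gamma]; congr (_, _, _, _); exact: esym (addr0 0).
- rewrite /alphabarA rho_beta // in_subspK ?gamma_beta; last exact: Mout_beta.
  by rewrite !oppr0 in_subsp0.
- have [y My E] := subspaceE w2; have [Ms as0] := subspaceE (sigma w3).
  rewrite in_subspK; first by rewrite linearD /= E alpha_gamma as0 addr0.
  by apply: subspaceD => //; rewrite E; apply: Min_gamma.
Qed.

Lemma eta_tildeB_negligible u (x : Mbar k M (MbarB k M V)) :
  negligible S u -> eta_tildeB V rho u x = 0.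
Proof.
apply: eta_tilde_negligible => [y y'|m Mm|[[w1 w2] w3]] /=.
- have rhoD : rho (y + y') = rho y + rho y' by apply: linearD.
  have valD : val (y + y') = val y + val y' by [].
  rewrite /alphabarB rhoD valD gammaD quotsp_piD !opprD in_subspD;
    do ?[exact: ker_alpha_N_gamma]; congr (_, _, _); exact: esym (addr0 0).
- rewrite /alphabarB rho_beta // in_subspK ?gamma_beta; last exact: Mout_beta.
  by rewrite !oppr0 in_subsp0.
- by have [Mw aw] := subspaceE w2; rewrite in_subspK.
Qed.

Lemma eta_tildeC_negligible u (x : Mbar k M (MbarC k M V)) :
  negligible S u -> eta_tildeC V sigma u x = 0.
Proof.
apply: eta_tilde_negligible => [y y'|m Mm|[[w1 w2] w3]] /=.
- by rewrite /alphabarC quotsp_piD opprD; congr (_, _, _); rewrite addr0.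
- rewrite /alphabarC quotsp_pi_eq0 ?oppr0 //= in_subspK; last exact: Mout_beta.
  by exists m.
- have [Ms as0] := subspaceE (sigma w2).
  rewrite in_subspK; first by rewrite linearD /= alpha_gamma as0 addr0.
  by apply: subspaceD => //; apply: Min_gamma.
Qed.

End Descriptions.

End DecoratedRepresentation.

Theorem proposition6p12 (K : fieldType) (Q : quiver) (Q_loop_free : loop_free Q)
  (S : cpa K Q) (S_potential : is_potential S)
  (k : vert Q) (k_no_2cycle : no_2cycle_at k)
  (M : lmodType (jalg S)) (V : lmodType {ffun vert Q -> K})
  (S' : cpa K Q) (S'_potential : is_potential S') (SS' : cyc_equiv S S')
  (S'_k : no_cycle_at k S')
  (rho : {linear subsp (Mout k M) -> subsp (ker_gamma k M)})
  (rhoP : is_retraction rho)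
  (sigma : {linear ker_alpha_mod_im_gamma k M -> subsp (ker_alpha k M)})
  (sigmaP : is_section sigma) :
  let J := jacobian (mut_potential k S') in
  [/\ annihilates J (eta_tildeA V rho sigma),
      annihilates J (eta_tildeB V rho)
    & annihilates J (eta_tildeC V sigma)].
Proof.
move=> J; have JN u : J u -> negligible S u by apply: negligible_jacobian.
split=> u /JN Nu x.
- exact: eta_tildeA_negligible.
- exact: eta_tildeB_negligible.
- exact: eta_tildeC_negligible.
Qed.
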